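(* Let $L\colon\mathsf{A}\rightleftarrows\mathsf{X}\colon R$ be an adjunction ($L$ left adjoint to $R$) between topoi with $L$ preserving pullbacks. There is a double category ${}_L\mathbb{F}\mathbf{ine}\mathbb{R}\mathbf{ewrite}$ whose objects are the objects of $\mathsf{A}$, whose horizontal arrows of type $a\to b$ are structured cospans $La\to x\leftarrow Lb$, whose vertical arrows are spans in $\mathsf{A}$ with invertible arrows, and whose squares are fine rewrites of structured cospans $$\begin{array}{ccccc}La&\to&x&\leftarrow&La'\\ \uparrow&&\uparrow&&\uparrow\\ Lb&\to&y&\leftarrow&Lb'\\ \downarrow&&\downarrow&&\downarrow\\ Lc&\to&z&\leftarrow&Lc'\end{array}$$ in which the outer vertical arrows are isomorphisms and $y\to x$, $y\to z$ are monic.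
   Context: A topos is a category with finite limits that is cartesian closed and has a subobject classifier. ''Double category'' means pseudo double category: a category of objects $\mathbb{C}_0$ (objects and vertical arrows) and a category of arrows $\mathbb{C}_1$ (horizontal arrows and squares), with functors $U\colon\mathbb{C}_0\to\mathbb{C}_1$, $S,T\colon\mathbb{C}_1\to\mathbb{C}_0$ and $\odot\colon\mathbb{C}_1\times_{\mathbb{C}_0}\mathbb{C}_1\to\mathbb{C}_1$ compatible with sources and targets, and natural associativity and unit isomorphisms for $\odot$ that $S$ and $T$ send to identities and that satisfy the coherence axioms of a monoidal category. A structured cospan is a cospan $La\to x\leftarrow Lb$ in $\mathsf{X}$ with $a,b$ objects of $\mathsf{A}$. A span of structured cospans is a commuting diagram in $\mathsf{X}$ of the displayed $3\times3$ shape whose rows are structured cospans. An isomorphism from one span of structured cospans to another that agrees with it except that its central object is $y'$ in place of $y$ (with its own arrows to and from the unchanged objects) is an invertible arrow $\theta\colon y\to y'$ commuting with the arrows from $Lb$ and $Lb'$ and with the arrows to $x$ and $z$. A fine rewrite of structured cospans is an isomorphism class of spans of structured cospans whose outer vertical arrows are isomorphisms and whose central vertical arrows $y\to x$, $y\to z$ are monic. Horizontal composition is by pushout in each row: rows $La\to v\leftarrow La'$ and $La'\to v'\leftarrow La''$ give $La\to v+_{La'}v'\leftarrow La''$, with the induced vertical arrows. Vertical composition of a square with middle row $Lb\to w\leftarrow Lb'$ and bottom row $Lc\to x\leftarrow Lc'$ with a square with top row $Lc\to x\leftarrow Lc'$ and middle row $Ld\to y\leftarrow Ld'$ has the top row of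 the first, the bottom row of the second, and middle row $L(b\times_c d)\to w\times_x y\leftarrow L(b'\times_{c'}d')$, where $L(b\times_c d)$ is the pullback of $Lb$ and $Ld$ over $Lc$, as $L$ preserves pullbacks. *)

(* Defs.v *)
From Stdlib Require Import List.

Set Implicit Arguments.
Unset Strict Implicit.
Unset Printing Implicit Defensive.

Declare Scope cat_scope.
Delimit Scope cat_scope with cat.
Local Open Scope cat_scope.

(** * Categories, functors, adjunctions *)

Record Category := {
  Ob :> Type;
  Hom : Ob -> Ob -> Type;
  idm : forall a, Hom a a;
  comp : forall a b c, Hom b c -> Hom a b -> Hom a c;
  comp_idl : forall a b (f : Hom a b), comp (idm b) f = f;
  comp_idr : forall a b (f : Hom a b), comp f (idm a) = f;
  comp_assoc : forall a b c d (h : Hom c d) (g : Hom b c) (f : Hom a b),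
    comp h (comp g f) = comp (comp h g) f }.

Arguments idm {_} a.
Arguments comp {_ _ _ _} g f.
Notation "g 'o' f" := (comp g f) (at level 40, left associativity) : cat_scope.

Record Functor (C D : Category) := {
  fob :> C -> D;
  fmap : forall a b, Hom a b -> Hom (fob a) (fob b);
  fmap_id : forall a, fmap (idm a) = idm (fob a);
  fmap_comp : forall a b c (g : Hom b c) (f : Hom a b),
    fmap (g o f) = fmap g o fmap f }.

Arguments fmap {_ _} F {_ _} f : rename.

Record Adjunction (A X : Category) (L : Functor A X) (R : Functor X A) := {
  adj_unit : forall a, Hom a (R (L a));
  adj_counit : forall x, Hom (L (R x)) x;
  unit_nat : forall a b (f : Hom a b),
    adj_unit b o f = fmap R (fmap L f) o adj_unit a;
  counit_nat : forall x y (f : Hom x y),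
    adj_counit y o fmap L (fmap R f) = f o adj_counit x;
  triangle_L : forall a, adj_counit (L a) o fmap L (adj_unit a) = idm (L a);
  triangle_R : forall x, fmap R (adj_counit x) o adj_unit (R x) = idm (R x) }.

Definition Mono (C : Category) (a b : C) (m : Hom a b) : Prop :=
  forall c (f g : Hom c a), m o f = m o g -> f = g.

Definition IsIso (C : Category) (a b : C) (f : Hom a b) : Prop :=
  exists g : Hom b a, g o f = idm a /\ f o g = idm b.

(** * Limits and topoi *)

Definition FiniteType (T : Type) : Prop := exists l : list T, forall x, In x l.

Definition FiniteCategory (J : Category) : Prop :=
  FiniteType J /\ forall i j : J, FiniteType (Hom i j).

Record Cone (J C : Category) (F : Functor J C) := {
  cone_pt : C;
  cone_leg : forall j, Hom cone_pt (F j);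
  cone_nat : forall i j (u : Hom i j), fmap F u o cone_leg i = cone_leg j }.

Definition IsLimit (J C : Category) (F : Functor J C) (K : Cone F) : Prop :=
  forall K' : Cone F, exists! h : Hom (cone_pt K') (cone_pt K),
    forall j, cone_leg K j o h = cone_leg K' j.

Definition HasFiniteLimits (C : Category) : Prop :=
  forall (J : Category) (F : Functor J C), FiniteCategory J ->
    exists K : Cone F, IsLimit K.

Definition IsTerminal (C : Category) (t : C) : Prop :=
  forall a : C, exists! f : Hom a t, True.

Definition IsProduct (C : Category) (a b p : C) (p1 : Hom p a) (p2 : Hom p b) :
  Prop :=
  forall t (f : Hom t a) (g : Hom t b),
    exists! h : Hom t p, p1 o h = f /\ p2 o h = g.

Definition IsPullback (C : Category) (b d c p : C) (f : Hom b c) (g : Hom d c)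
  (p1 : Hom p b) (p2 : Hom p d) : Prop :=
  f o p1 = g o p2 /\
  forall t (h : Hom t b) (k : Hom t d), f o h = g o k ->
    exists! r : Hom t p, p1 o r = h /\ p2 o r = k.

Definition IsPushout (C : Category) (a b d p : C) (f : Hom a b) (g : Hom a d)
  (i1 : Hom b p) (i2 : Hom d p) : Prop :=
  i1 o f = i2 o g /\
  forall t (h : Hom b t) (k : Hom d t), h o f = k o g ->
    exists! r : Hom p t, r o i1 = h /\ r o i2 = k.

(* [q] with [q1, q2] is a product of [e] and [b], and [ev] is the evaluation
   of the exponential [e] of [c] by [b]; below, [h] is the map [g x b]. *)
Definition IsExponential (C : Category) (b c e q : C)
  (q1 : Hom q e) (q2 : Hom q b) (ev : Hom q c) : Prop :=
  IsProduct q1 q2 /\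
  forall (d p : C) (p1 : Hom p d) (p2 : Hom p b), IsProduct p1 p2 ->
  forall f : Hom p c, exists! g : Hom d e,
    exists h : Hom p q, q1 o h = g o p1 /\ q2 o h = p2 /\ ev o h = f.

Record CartesianClosed (C : Category) : Prop := {
  has_terminal : exists t : C, IsTerminal t;
  has_products : forall a b : C,
    exists (p : C) (p1 : Hom p a) (p2 : Hom p b), IsProduct p1 p2;
  has_exponentials : forall b c : C,
    exists (e q : C) (q1 : Hom q e) (q2 : Hom q b) (ev : Hom q c),
      IsExponential q1 q2 ev }.

Definition HasSubobjectClassifier (C : Category) : Prop :=
  exists (one omega : C) (tr : Hom one omega), IsTerminal one /\
    forall (s x : C) (m : Hom s x), Mono m ->
      exists! chi : Hom x omega,
        exists k : Hom s one, IsPullback chi tr m k.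

Record IsTopos (C : Category) : Prop := {
  topos_limits : HasFiniteLimits C;
  topos_closed : CartesianClosed C;
  topos_classifier : HasSubobjectClassifier C }.

Definition PreservesPullbacks (C D : Category) (F : Functor C D) : Prop :=
  forall (b d c p : C) (f : Hom b c) (g : Hom d c) (p1 : Hom p b) (p2 : Hom p d),
    IsPullback f g p1 p2 ->
    IsPullback (fmap F f) (fmap F g) (fmap F p1) (fmap F p2).

(** * Pseudo double categories *)

(* [sq u v M N] is the type of squares with top [M], bottom [N], left side [u]
   and right side [v]. *)
Record DoubleGraph := {
  dob :> Type;
  ver : dob -> dob -> Type;
  hor : dob -> dob -> Type;
  sq : forall a b c d, ver a c -> ver b d -> hor a b -> hor c d -> Type }.

Arguments sq {_ _ _ _ _} u v M N.

(* Objects and arrows of the category of arrows.  The source and target functors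
   are the projections [asrc, atgt] on objects and [ssrc, stgt] on arrows. *)
Record Arrow (G : DoubleGraph) :=
  MkArrow { asrc : G; atgt : G; aarr : hor asrc atgt }.

Record Square (G : DoubleGraph) (M N : Arrow G) := MkSquare {
  ssrc : ver (asrc M) (asrc N);
  stgt : ver (atgt M) (atgt N);
  scell : sq ssrc stgt (aarr M) (aarr N) }.

Definition arrow (G : DoubleGraph) (a b : G) (M : hor a b) : Arrow G := MkArrow M.

Definition square (G : DoubleGraph) (a b c d : G) (u : ver a c) (v : ver b d)
  (M : hor a b) (N : hor c d) (s : sq u v M N) : Square (arrow M) (arrow N) :=
  @MkSquare G (arrow M) (arrow N) u v s.

(* Vertical composition [vcomp u u'] and [scomp s s'] is in diagrammatic order.
   Equations between squares are equations in [Square], hence include the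
   equality of the vertical sides. *)
Record VerticalStructure (G : DoubleGraph) := {
  vid : forall a : G, ver a a;
  vcomp : forall a c e : G, ver a c -> ver c e -> ver a e;
  vcomp_idl : forall (a c : G) (u : ver a c), vcomp (vid a) u = u;
  vcomp_idr : forall (a c : G) (u : ver a c), vcomp u (vid c) = u;
  vcomp_assoc : forall (a b c d : G) (u : ver a b) (v : ver b c) (w : ver c d),
    vcomp (vcomp u v) w = vcomp u (vcomp v w);
  sid : forall (a b : G) (M : hor a b), sq (vid a) (vid b) M M;
  scomp : forall (a b c d e f : G) (u : ver a c) (v : ver b d)
    (u' : ver c e) (v' : ver d f) (M : hor a b) (N : hor c d) (K : hor e f),
    sq u v M N -> sq u' v' N K -> sq (vcomp u u') (vcomp v v') M K;
  scomp_idl : forall (a b c d : G) (u : ver a c) (v : ver b d)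
    (M : hor a b) (N : hor c d) (s : sq u v M N),
    square (scomp (sid M) s) = square s;
  scomp_idr : forall (a b c d : G) (u : ver a c) (v : ver b d)
    (M : hor a b) (N : hor c d) (s : sq u v M N),
    square (scomp s (sid N)) = square s;
  scomp_assoc : forall (a b c d e f g h : G) (u : ver a c) (v : ver b d)
    (u' : ver c e) (v' : ver d f) (u'' : ver e g) (v'' : ver f h)
    (M : hor a b) (N : hor c d) (K : hor e f) (P : hor g h)
    (s : sq u v M N) (s' : sq u' v' N K) (s'' : sq u'' v'' K P),
    square (scomp (scomp s s') s'') = square (scomp s (scomp s' s'')) }.

Arguments vid {_} _ a.
Arguments vcomp {_} _ {_ _ _} u u'.
Arguments sid {_} _ {_ _} M.
Arguments scomp {_} _ {_ _ _ _ _ _ _ _ _ _ _ _ _} s s'.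

Definition C0 (G : DoubleGraph) (V : VerticalStructure G) : Category := {|
  Ob := G;
  Hom := @ver G;
  idm := vid V;
  comp := fun a b c g f => vcomp V f g;
  comp_idl := fun a b f => vcomp_idr V f;
  comp_idr := fun a b f => vcomp_idl V f;
  comp_assoc := fun a b c d h g f => vcomp_assoc V f g h |}.

Lemma square_eta (G : DoubleGraph) (M N : Arrow G) (s : Square M N) :
  MkSquare (scell s) = s.
Proof. destruct s; reflexivity. Qed.

Section CategoryOfArrows.
Variables (G : DoubleGraph) (V : VerticalStructure G).

Definition C1_id (M : Arrow G) : Square M M := MkSquare (sid V (aarr M)).

Definition C1_comp (M N K : Arrow G) (t : Square N K) (s : Square M N) :
  Square M K := MkSquare (scomp V (scell s) (scell t)).

Lemma C1_idl (M N : Arrow G) (s : Square M N) : C1_comp (C1_id N) s = s.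
Proof.
destruct M as [a b M], N as [c d N], s as [u v s].
exact (scomp_idr V s).
Qed.

Lemma C1_idr (M N : Arrow G) (s : Square M N) : C1_comp s (C1_id M) = s.
Proof.
destruct M as [a b M], N as [c d N], s as [u v s].
exact (scomp_idl V s).
Qed.

Lemma C1_assoc (M N K P : Arrow G)
  (r : Square K P) (t : Square N K) (s : Square M N) :
  C1_comp r (C1_comp t s) = C1_comp (C1_comp r t) s.
Proof.
destruct M as [a b M], N as [c d N], K as [e f K], P as [g h P].
destruct s as [u v s], t as [u' v' t], r as [u'' v'' r].
exact (scomp_assoc V s t r).
Qed.

Definition C1 : Category := {|
  Ob := Arrow G;
  Hom := @Square G;
  idm := C1_id;
  comp := C1_comp;
  comp_idl := C1_idl;
  comp_idr := C1_idr;
  comp_assoc := C1_assoc |}.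

Definition Sfun : Functor C1 (C0 V) := {|
  fob := (@asrc G : C1 -> C0 V);
  fmap := fun M N s => ssrc s;
  fmap_id := fun M => eq_refl;
  fmap_comp := fun M N K t s => eq_refl |}.

Definition Tfun : Functor C1 (C0 V) := {|
  fob := (@atgt G : C1 -> C0 V);
  fmap := fun M N s => stgt s;
  fmap_id := fun M => eq_refl;
  fmap_comp := fun M N K t s => eq_refl |}.

(* A square, seen as an arrow of the category of arrows. *)
Definition cell (a b c d : G) (u : ver a c) (v : ver b d)
  (M : hor a b) (N : hor c d) (s : sq u v M N) :
  @Hom C1 (arrow M) (arrow N) := square s.

End CategoryOfArrows.

Arguments cell {G} V {a b c d u v M N} s.

(* A pseudo double category whose objects, arrows and squares are those of [G].
   [hcomp M N] is [M] followed by [N].  The typing of [hunit_sq], [hcomp_sq]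
   and of the structure squares expresses the compatibility with sources and
   targets, and that [S] and [T] send the structure squares to identities. *)
Record DoubleCategoryOn (G : DoubleGraph) := {
  vert :> VerticalStructure G;
  (* U *)
  hunit : forall a : G, hor a a;
  hunit_sq : forall (a c : G) (u : ver a c), sq u u (hunit a) (hunit c);
  hunit_id : forall a : G, hunit_sq (vid vert a) = sid vert (hunit a);
  hunit_comp : forall (a c e : G) (u : ver a c) (u' : ver c e),
    hunit_sq (vcomp vert u u') = scomp vert (hunit_sq u) (hunit_sq u');
  (* horizontal composition *)
  hcomp : forall a b c : G, hor a b -> hor b c -> hor a c;
  hcomp_sq : forall (a b c a' b' c' : G)
    (u : ver a a') (v : ver b b') (w : ver c c')
    (M : hor a b) (N : hor b c) (M' : hor a' b') (N' : hor b' c'),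
    sq u v M M' -> sq v w N N' -> sq u w (hcomp M N) (hcomp M' N');
  hcomp_id : forall (a b c : G) (M : hor a b) (N : hor b c),
    hcomp_sq (sid vert M) (sid vert N) = sid vert (hcomp M N);
  hcomp_comp : forall (a b c a' b' c' a'' b'' c'' : G)
    (u : ver a a') (v : ver b b') (w : ver c c')
    (u' : ver a' a'') (v' : ver b' b'') (w' : ver c' c'')
    (M : hor a b) (N : hor b c) (M' : hor a' b') (N' : hor b' c')
    (M'' : hor a'' b'') (N'' : hor b'' c'')
    (s : sq u v M M') (t : sq v w N N') (s' : sq u' v' M' M'') (t' : sq v' w' N' N''),
    hcomp_sq (scomp vert s s') (scomp vert t t')
    = scomp vert (hcomp_sq s t) (hcomp_sq s' t');
  (* associativity and unit isomorphisms *)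
  hassoc : forall (a b c d : G) (M : hor a b) (N : hor b c) (P : hor c d),
    sq (vid vert a) (vid vert d) (hcomp (hcomp M N) P) (hcomp M (hcomp N P));
  hlunit : forall (a b : G) (M : hor a b),
    sq (vid vert a) (vid vert b) (hcomp (hunit a) M) M;
  hrunit : forall (a b : G) (M : hor a b),
    sq (vid vert a) (vid vert b) (hcomp M (hunit b)) M;
  hassoc_iso : forall (a b c d : G) (M : hor a b) (N : hor b c) (P : hor c d),
    IsIso (cell vert (hassoc M N P));
  hlunit_iso : forall (a b : G) (M : hor a b), IsIso (cell vert (hlunit M));
  hrunit_iso : forall (a b : G) (M : hor a b), IsIso (cell vert (hrunit M));
  hassoc_nat : forall (a b c d a' b' c' d' : G)
    (u : ver a a') (v : ver b b') (w : ver c c') (x : ver d d')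
    (M : hor a b) (N : hor b c) (P : hor c d)
    (M' : hor a' b') (N' : hor b' c') (P' : hor c' d')
    (r : sq u v M M') (s : sq v w N N') (t : sq w x P P'),
    cell vert (hassoc M' N' P') o cell vert (hcomp_sq (hcomp_sq r s) t)
    = cell vert (hcomp_sq r (hcomp_sq s t)) o cell vert (hassoc M N P);
  hlunit_nat : forall (a b a' b' : G) (u : ver a a') (v : ver b b')
    (M : hor a b) (M' : hor a' b') (s : sq u v M M'),
    cell vert (hlunit M') o cell vert (hcomp_sq (hunit_sq u) s)
    = cell vert s o cell vert (hlunit M);
  hrunit_nat : forall (a b a' b' : G) (u : ver a a') (v : ver b b')
    (M : hor a b) (M' : hor a' b') (s : sq u v M M'),
    cell vert (hrunit M') o cell vert (hcomp_sq s (hunit_sq v))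
    = cell vert s o cell vert (hrunit M);
  (* coherence *)
  pentagon : forall (a b c d e : G)
    (M : hor a b) (N : hor b c) (P : hor c d) (Q : hor d e),
    cell vert (hcomp_sq (sid vert M) (hassoc N P Q))
      o cell vert (hassoc M (hcomp N P) Q)
      o cell vert (hcomp_sq (hassoc M N P) (sid vert Q))
    = cell vert (hassoc M N (hcomp P Q)) o cell vert (hassoc (hcomp M N) P Q);
  triangle : forall (a b c : G) (M : hor a b) (N : hor b c),
    cell vert (hcomp_sq (sid vert M) (hlunit N))
      o cell vert (hassoc M (hunit b) N)
    = cell vert (hcomp_sq (hrunit M) (sid vert N)) }.

Arguments hcomp {_} _ {_ _ _} M N.
Arguments hcomp_sq {_} _ {_ _ _ _ _ _ _ _ _ _ _ _ _} s t.

(** * Structured cospans and fine rewrites *)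

Record InvSpan (C : Category) (a c : C) := {
  sapex : C;
  sup : Hom sapex a;
  sdown : Hom sapex c;
  sup_iso : IsIso sup;
  sdown_iso : IsIso sdown }.

Section FineRewriting.
Variables (A X : Category) (L : Functor A X).

Record StructuredCospan (a b : A) := {
  capex : X;
  cleft : Hom (L a) capex;
  cright : Hom (L b) capex }.

(* Spans of structured cospans with top row [M], bottom row [N], and outer
   columns the images under [L] of the spans [u] and [v]. *)
Record SpanOfCospans (a a' c c' : A) (u : InvSpan a c) (v : InvSpan a' c')
  (M : StructuredCospan a a') (N : StructuredCospan c c') := {
  mid : StructuredCospan (sapex u) (sapex v);
  up : Hom (capex mid) (capex M);
  down : Hom (capex mid) (capex N);
  up_left : up o cleft mid = cleft M o fmap L (sup u);
  up_right : up o cright mid = cright M o fmap L (sup v);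
  down_left : down o cleft mid = cleft N o fmap L (sdown u);
  down_right : down o cright mid = cright N o fmap L (sdown v) }.

Section Squares.
Variables (a a' c c' : A) (u : InvSpan a c) (v : InvSpan a' c').
Variables (M : StructuredCospan a a') (N : StructuredCospan c c').

Definition IsoSpan (s t : SpanOfCospans u v M N) : Prop :=
  exists theta : Hom (capex (mid s)) (capex (mid t)), IsIso theta
    /\ theta o cleft (mid s) = cleft (mid t)
    /\ theta o cright (mid s) = cright (mid t)
    /\ up t o theta = up s
    /\ down t o theta = down s.

Definition Fine (s : SpanOfCospans u v M N) : Prop :=
  (IsIso (fmap L (sup u)) /\ IsIso (fmap L (sdown u))
   /\ IsIso (fmap L (sup v)) /\ IsIso (fmap L (sdown v)))
  /\ Mono (up s) /\ Mono (down s).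

(* Isomorphism classes, as predicates. *)
Definition FineRewrite : Type :=
  { cls : SpanOfCospans u v M N -> Prop |
    exists s, Fine s /\ forall t, cls t <-> IsoSpan s t }.

Definition InClass (s : SpanOfCospans u v M N) (r : FineRewrite) : Prop :=
  proj1_sig r s.

End Squares.

Definition FineRewriteGraph : DoubleGraph := {|
  dob := A;
  ver := @InvSpan A;
  hor := StructuredCospan;
  sq := fun a a' c c' u v M N => @FineRewrite a a' c c' u v M N |}.

(* [w] is the composite of [u] and [v] by pullback, with projections [p1, p2]. *)
Definition SpanComposite (a c e : A) (u : InvSpan a c) (v : InvSpan c e)
  (w : InvSpan a e) (p1 : Hom (sapex w) (sapex u)) (p2 : Hom (sapex w) (sapex v)) :
  Prop :=
  IsPullback (sdown u) (sup v) p1 p2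
  /\ sup w = sup u o p1 /\ sdown w = sdown v o p2.

(* [K] is the composite of [M] and [N] by pushout, with injections [i1, i2]. *)
Definition CospanComposite (a b c : A)
  (M : StructuredCospan a b) (N : StructuredCospan b c) (K : StructuredCospan a c)
  (i1 : Hom (capex M) (capex K)) (i2 : Hom (capex N) (capex K)) : Prop :=
  IsPushout (cright M) (cleft N) i1 i2
  /\ cleft K = i1 o cleft M /\ cright K = i2 o cright N.

(* [r] is the vertical composite of [s] (above) and [t] (below), where [p1, p2]
   and [q1, q2] are the projections of the left and right composite spans. *)
Definition VerticalComposite (a a' c c' e e' : A)
  (u : InvSpan a c) (v : InvSpan a' c') (u' : InvSpan c e) (v' : InvSpan c' e')
  (uu : InvSpan a e) (vv : InvSpan a' e')
  (p1 : Hom (sapex uu) (sapex u)) (p2 : Hom (sapex uu) (sapex u'))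
  (q1 : Hom (sapex vv) (sapex v)) (q2 : Hom (sapex vv) (sapex v'))
  (M : StructuredCospan a a') (N : StructuredCospan c c') (K : StructuredCospan e e')
  (s : SpanOfCospans u v M N) (t : SpanOfCospans u' v' N K)
  (r : SpanOfCospans uu vv M K) : Prop :=
  exists (m1 : Hom (capex (mid r)) (capex (mid s)))
         (m2 : Hom (capex (mid r)) (capex (mid t))),
    IsPullback (down s) (up t) m1 m2
    /\ up r = up s o m1 /\ down r = down t o m2
    /\ m1 o cleft (mid r) = cleft (mid s) o fmap L p1
    /\ m2 o cleft (mid r) = cleft (mid t) o fmap L p2
    /\ m1 o cright (mid r) = cright (mid s) o fmap L q1
    /\ m2 o cright (mid r) = cright (mid t) o fmap L q2.

(* [r] is the horizontal composite of [s] (left) and [t] (right), where [i1, i2]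
   and [j1, j2] are the injections of the composite top and bottom rows. *)
Definition HorizontalComposite (a b c a' b' c' : A)
  (u : InvSpan a a') (v : InvSpan b b') (w : InvSpan c c')
  (M : StructuredCospan a b) (N : StructuredCospan b c)
  (M' : StructuredCospan a' b') (N' : StructuredCospan b' c')
  (K : StructuredCospan a c) (K' : StructuredCospan a' c')
  (i1 : Hom (capex M) (capex K)) (i2 : Hom (capex N) (capex K))
  (j1 : Hom (capex M') (capex K')) (j2 : Hom (capex N') (capex K'))
  (s : SpanOfCospans u v M M') (t : SpanOfCospans v w N N')
  (r : SpanOfCospans u w K K') : Prop :=
  exists (k1 : Hom (capex (mid s)) (capex (mid r)))
         (k2 : Hom (capex (mid t)) (capex (mid r))),
    @CospanComposite (sapex u) (sapex v) (sapex w) (mid s) (mid t) (mid r) k1 k2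
    /\ up r o k1 = i1 o up s /\ up r o k2 = i2 o up t
    /\ down r o k1 = j1 o down s /\ down r o k2 = j2 o down t.

(* The two compositions of [D] are computed by pullbacks and pushouts, for a
   fixed choice of the projections of composite vertical arrows and of the
   injections of composite horizontal arrows. *)
Record ComposesByPullbackAndPushout (D : DoubleCategoryOn FineRewriteGraph)
  (p1 : forall (a c e : A) (u : InvSpan a c) (v : InvSpan c e),
    Hom (sapex (vcomp (G := FineRewriteGraph) D u v)) (sapex u))
  (p2 : forall (a c e : A) (u : InvSpan a c) (v : InvSpan c e),
    Hom (sapex (vcomp (G := FineRewriteGraph) D u v)) (sapex v))
  (i1 : forall (a b c : A) (M : StructuredCospan a b) (N : StructuredCospan b c),
    Hom (capex M) (capex (hcomp (G := FineRewriteGraph) D M N)))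
  (i2 : forall (a b c : A) (M : StructuredCospan a b) (N : StructuredCospan b c),
    Hom (capex N) (capex (hcomp (G := FineRewriteGraph) D M N))) : Prop := {
  vertical_arrows : forall (a c e : A) (u : InvSpan a c) (v : InvSpan c e),
    SpanComposite (p1 a c e u v) (p2 a c e u v);
  horizontal_arrows : forall (a b c : A)
    (M : StructuredCospan a b) (N : StructuredCospan b c),
    CospanComposite (i1 a b c M N) (i2 a b c M N);
  vertical_squares : forall (a a' c c' e e' : A)
    (u : InvSpan a c) (v : InvSpan a' c') (u' : InvSpan c e) (v' : InvSpan c' e')
    (M : StructuredCospan a a') (N : StructuredCospan c c') (K : StructuredCospan e e')
    (x : FineRewrite u v M N) (y : FineRewrite u' v' N K)
    (s : SpanOfCospans u v M N) (t : SpanOfCospans u' v' N K),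
    InClass s x -> InClass t y ->
    exists r, InClass r (scomp (G := FineRewriteGraph) D x y)
      /\ VerticalComposite (p1 a c e u u') (p2 a c e u u')
           (p1 a' c' e' v v') (p2 a' c' e' v v') s t r;
  horizontal_squares : forall (a b c a' b' c' : A)
    (u : InvSpan a a') (v : InvSpan b b') (w : InvSpan c c')
    (M : StructuredCospan a b) (N : StructuredCospan b c)
    (M' : StructuredCospan a' b') (N' : StructuredCospan b' c')
    (x : FineRewrite u v M M') (y : FineRewrite v w N N')
    (s : SpanOfCospans u v M M') (t : SpanOfCospans v w N N'),
    InClass s x -> InClass t y ->
    exists r, InClass r (hcomp_sq (G := FineRewriteGraph) D x y)
      /\ HorizontalComposite (i1 a b c M N) (i2 a b c M N)
           (i1 a' b' c' M' N') (i2 a' b' c' M' N') s t r }.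

End FineRewriting.

(* Main.v *)
(* A fine rewrite is determined by its two central arrows, because these are
   monic.  Vertical composition intersects subobjects of the middle row and
   horizontal composition is a pushout.  Interchange therefore rests on two facts:
   for subobjects of [x] and [x'] that contain [c], the pushout over [c] is a
   subobject of the pushout of [x] and [x'], and it restricts to the given ones; and
   pushouts are stable under restriction to a subobject.  They hold because a
   characteristic map on a pushout is a compatible pair of characteristic maps.

   Pushouts in an elementary topos are built from power objects: writing [Q] for
   the object of compatible pairs of subobjects of [x] and [x'], the pushout is the
   least subobject of [P Q] containing the principal ultrafilters of [x] and [x'].
   It has the universal property because the map [t -> P (P t)] to principal
   ultrafilters is monic.

   Vertical arrows must compose strictly, although pullbacks only compose up to
   isomorphism; the composite spans are chosen by means of a monoid structure on
   the possible choices of their apexes. *)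

From Stdlib Require Import List ClassicalEpsilon FunctionalExtensionality
  PropExtensionality.
Require Import Defs.

Set Implicit Arguments.
Unset Strict Implicit.
Unset Printing Implicit Defensive.

Local Open Scope cat_scope.

(** Vertical arrows are spans themselves, not isomorphism classes of spans, so the unit and
    associativity laws are equations between chosen apexes. As all legs are invertible, every
    commuting square of the required shape with invertible projections is a pullback. A span from
    [a] to [c] is thus an isomorphism from [a] to [c], which composes strictly, together with an
    object over [a] by an isomorphism; only the latter is subject to choice. Such objects must be
    carried from [c] to [a] before they can be multiplied. Doing so along the isomorphism of the
    span would fail, since a nontrivial automorphism moves the unit; they are carried along a
    coherent family of isomorphisms that depends on the end points alone. For squares, the same
    invertibility moves the feet of a central row from the image of an apex to [L a]. A leg of the
    central row is then the only factorization of a leg of the top row through a monic arrow, so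
    that its existence is all that has to be recorded. *)

Notation choose := constructive_indefinite_description.

Lemma whisker2 (C : Category) (a b c d : C) (k : Hom c d) (g : Hom b c)
  (f : Hom a b) (h : Hom a c) : g o f = h -> k o g o f = k o h.
Proof. intros E. now rewrite <- E, comp_assoc. Qed.

Lemma whisker3 (C : Category) (a b c d e : C) (k : Hom d e) (h : Hom c d)
  (g : Hom b c) (f : Hom a b) (l : Hom a d) :
  h o g o f = l -> k o h o g o f = k o l.
Proof. intros E. now rewrite <- E, !comp_assoc. Qed.

Ltac assoc := rewrite ?comp_assoc, ?comp_idl, ?comp_idr.

(* Composites are kept associated to the left; the left-hand side of [H] may
   then occur with an extra factor in front of it. *)
Tactic Notation "rw" constr(H) :=
  assoc;
  (let E := fresh in pose proof H as E; rewrite ?comp_assoc in E;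
   first [rewrite E | rewrite (whisker2 _ E) | rewrite (whisker3 _ E)]; clear E);
  assoc.

(** * Monomorphisms, isomorphisms, pullbacks and pushouts *)

Section Basics.
Variable C : Category.

Lemma mono_comp (a b d : C) (m : Hom b d) (n : Hom a b) :
  Mono m -> Mono n -> Mono (m o n).
Proof.
intros Hm Hn e f g E. apply Hn, Hm. now rewrite !comp_assoc.
Qed.

Lemma iso_mono (a b : C) (f : Hom a b) : IsIso f -> Mono f.
Proof.
intros [g [E _]] d h k H.
rewrite <- (comp_idl h), <- (comp_idl k), <- E, <- !comp_assoc. now rewrite H.
Qed.

Lemma iso_id (a : C) : IsIso (idm a).
Proof. exists (idm a). now rewrite comp_idl. Qed.

Lemma iso_comp (a b d : C) (g : Hom b d) (f : Hom a b) :
  IsIso g -> IsIso f -> IsIso (g o f).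
Proof.
intros [g' [G1 G2]] [f' [F1 F2]]. exists (f' o g'). split.
- rw G1. exact F1.
- rw F2. exact G2.
Qed.

Lemma mono_section (a b : C) (m : Hom a b) (z : Hom b a) :
  Mono m -> m o z = idm b -> IsIso m.
Proof.
intros Hm E. exists z. split; [apply Hm | exact E]. rw E. reflexivity.
Qed.

Lemma iso_epi (a b d : C) (s : Hom a b) (f g : Hom b d) :
  IsIso s -> f o s = g o s -> f = g.
Proof.
intros [t [_ E]] H.
rewrite <- (comp_idr f), <- (comp_idr g), <- E, !comp_assoc. now rewrite H.
Qed.

Definition inv (a b : C) (f : Hom a b) (H : IsIso f) : Hom b a :=
  proj1_sig (choose _ H).

Lemma inv_l (a b : C) (f : Hom a b) (H : IsIso f) : inv H o f = idm a.
Proof. exact (proj1 (proj2_sig (choose _ H))). Qed.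

Lemma inv_r (a b : C) (f : Hom a b) (H : IsIso f) : f o inv H = idm b.
Proof. exact (proj2 (proj2_sig (choose _ H))). Qed.

Lemma iso_inv (a b : C) (f : Hom a b) (H : IsIso f) : IsIso (inv H).
Proof. exists f. split; [apply inv_r | apply inv_l]. Qed.

Section Pullbacks.
Variables (b d c p : C) (f : Hom b c) (g : Hom d c) (p1 : Hom p b) (p2 : Hom p d).

Lemma pb_comm : IsPullback f g p1 p2 -> f o p1 = g o p2.
Proof. now intros [H _]. Qed.

Lemma pb_lift : IsPullback f g p1 p2 ->
  forall t (h : Hom t b) (k : Hom t d), f o h = g o k ->
  exists r : Hom t p, p1 o r = h /\ p2 o r = k.
Proof. intros [_ H] t h k E. destruct (H t h k E) as [r [Hr _]]. now exists r. Qed.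

Lemma pb_unique : IsPullback f g p1 p2 ->
  forall t (r r' : Hom t p), p1 o r = p1 o r' -> p2 o r = p2 o r' -> r = r'.
Proof.
intros [E H] t r r' E1 E2.
destruct (H t (p1 o r) (p2 o r)) as [s [_ Hs]]; [now rewrite !comp_assoc, E |].
rewrite <- (Hs r), <- (Hs r'); auto.
Qed.

Lemma pb_mono_l : IsPullback f g p1 p2 -> Mono g -> Mono p1.
Proof.
intros H Hg t r r' E. apply (pb_unique H E), Hg. rewrite !comp_assoc.
rewrite <- (pb_comm H), <- !comp_assoc. now rewrite E.
Qed.

Lemma pb_mono_r : IsPullback f g p1 p2 -> Mono f -> Mono p2.
Proof.
intros H Hg t r r' E. refine (pb_unique H _ E). apply Hg. rewrite !comp_assoc.
rewrite (pb_comm H), <- !comp_assoc. now rewrite E.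
Qed.

Lemma pb_intro : f o p1 = g o p2 ->
  (forall t (h : Hom t b) (k : Hom t d), f o h = g o k ->
     exists r : Hom t p, p1 o r = h /\ p2 o r = k) ->
  (forall t (r r' : Hom t p), p1 o r = p1 o r' -> p2 o r = p2 o r' -> r = r') ->
  IsPullback f g p1 p2.
Proof.
intros E H U. split; [exact E |]. intros t h k Ehk.
destruct (H t h k Ehk) as [r [R1 R2]]. exists r. split; [auto |].
intros r' [R1' R2']. apply U; congruence.
Qed.

End Pullbacks.

Lemma pb_sym (b d c p : C) (f : Hom b c) (g : Hom d c) (p1 : Hom p b) (p2 : Hom p d) :
  IsPullback f g p1 p2 -> IsPullback g f p2 p1.
Proof.
intros H. apply pb_intro.
- symmetry. exact (pb_comm H).
- intros t h k E. destruct (pb_lift H (eq_sym E)) as [r [R1 R2]]. now exists r.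
- intros t r r' E1 E2. exact (pb_unique H E2 E1).
Qed.

Section Pushouts.
Variables (a b d p : C) (f : Hom a b) (g : Hom a d) (i1 : Hom b p) (i2 : Hom d p).

Lemma po_comm : IsPushout f g i1 i2 -> i1 o f = i2 o g.
Proof. now intros [H _]. Qed.

Lemma po_desc : IsPushout f g i1 i2 ->
  forall t (h : Hom b t) (k : Hom d t), h o f = k o g ->
  exists r : Hom p t, r o i1 = h /\ r o i2 = k.
Proof. intros [_ H] t h k E. destruct (H t h k E) as [r [Hr _]]. now exists r. Qed.

Lemma po_unique : IsPushout f g i1 i2 ->
  forall t (r r' : Hom p t), r o i1 = r' o i1 -> r o i2 = r' o i2 -> r = r'.
Proof.
intros [E H] t r r' E1 E2.
destruct (H t (r o i1) (r o i2)) as [s [_ Hs]]; [now rewrite <- !comp_assoc, E |].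
rewrite <- (Hs r), <- (Hs r'); auto.
Qed.

Lemma po_intro : i1 o f = i2 o g ->
  (forall t (h : Hom b t) (k : Hom d t), h o f = k o g ->
     exists r : Hom p t, r o i1 = h /\ r o i2 = k) ->
  (forall t (r r' : Hom p t), r o i1 = r' o i1 -> r o i2 = r' o i2 -> r = r') ->
  IsPushout f g i1 i2.
Proof.
intros E H U. split; [exact E |]. intros t h k Ehk.
destruct (H t h k Ehk) as [r [R1 R2]]. exists r. split; [auto |].
intros r' [R1' R2']. apply U; congruence.
Qed.

End Pushouts.

Lemma po_iso (a b d p : C) (f : Hom a b) (g : Hom a d) (i1 : Hom b p) (i2 : Hom d p)
  (q : C) (j1 : Hom b q) (j2 : Hom d q) :
  IsPushout f g i1 i2 -> IsPushout f g j1 j2 ->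
  exists theta : Hom p q, IsIso theta /\ theta o i1 = j1 /\ theta o i2 = j2.
Proof.
intros H K.
destruct (po_desc H (po_comm K)) as [t [T1 T2]].
destruct (po_desc K (po_comm H)) as [s [S1 S2]].
exists t. split; [exists s; split | auto].
- apply (po_unique H); [rw T1; exact S1 | rw T2; exact S2].
- apply (po_unique K); [rw S1; exact T1 | rw S2; exact T2].
Qed.

Lemma po_of_iso (a b d p : C) (f : Hom a b) (g : Hom a d) (i1 : Hom b p) (i2 : Hom d p)
  (q : C) (theta : Hom p q) (j1 : Hom b q) (j2 : Hom d q) :
  IsPushout f g i1 i2 -> IsIso theta -> theta o i1 = j1 -> theta o i2 = j2 ->
  IsPushout f g j1 j2.
Proof.
intros H [s [S1 S2]] T1 T2. subst j1 j2. apply po_intro.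
- rw (po_comm H). reflexivity.
- intros t h k E. destruct (po_desc H E) as [r [R1 R2]].
  exists (r o s). split; rw S1; assumption.
- intros t r r' E1 E2.
  assert (E : r o theta = r' o theta).
  { apply (po_unique H); rewrite <- !comp_assoc; assumption. }
  apply (f_equal (fun z => z o s)) in E. rewrite <- !comp_assoc, S2, !comp_idr in E.
  exact E.
Qed.

Lemma po_precomp (a b d p : C) (f : Hom a b) (g : Hom a d) (i1 : Hom b p) (i2 : Hom d p)
  (a' : C) (s : Hom a' a) :
  IsIso s -> IsPushout f g i1 i2 -> IsPushout (f o s) (g o s) i1 i2.
Proof.
intros Hs H. apply po_intro.
- rw (po_comm H). reflexivity.
- intros t h k E. apply (po_desc H). apply (iso_epi Hs). now rewrite <- !comp_assoc.
- exact (po_unique H).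
Qed.

(** The colimit of the zigzag [x <- a -> y <- b -> z] can be formed in either order. The associator
    compares the two orders on rows, and its naturality does so on central objects. *)
Lemma po_assoc (a b x y z xy yz xyz : C)
  (f : Hom a x) (g : Hom a y) (h : Hom b y) (k : Hom b z)
  (i1 : Hom x xy) (i2 : Hom y xy) (j1 : Hom y yz) (j2 : Hom z yz)
  (l1 : Hom xy xyz) (l2 : Hom z xyz) (w : Hom yz xyz) :
  IsPushout f g i1 i2 -> IsPushout h k j1 j2 -> IsPushout (i2 o h) k l1 l2 ->
  w o j1 = l1 o i2 -> w o j2 = l2 -> IsPushout f (j1 o g) (l1 o i1) w.
Proof.
intros H K M W1 W2. apply po_intro.
- rw W1. rw (po_comm H). reflexivity.
- intros t u v E.
  destruct (po_desc H (t := t) (h := u) (k := v o j1)) as [r [R1 R2]].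
  { now rewrite <- comp_assoc. }
  destruct (po_desc M (t := t) (h := r) (k := v o j2)) as [s [S1 S2]].
  { rw R2. rw (po_comm K). reflexivity. }
  exists s. split.
  + rw S1. exact R1.
  + apply (po_unique K).
    * rw W1. rw S1. exact R2.
    * rw W2. exact S2.
- intros t r r' E1 E2. rewrite !comp_assoc in E1.
  apply (po_unique M).
  + apply (po_unique H); [exact E1 |].
    rewrite <- !comp_assoc, <- W1, !comp_assoc. now rewrite E2.
  + rewrite <- W2, !comp_assoc. now rewrite E2.
Qed.

End Basics.

Section PullbackAndPushoutCalculus.
Variable C : Category.

Lemma pb_iso (b d c p q : C) (f : Hom b c) (g : Hom d c)
  (p1 : Hom p b) (p2 : Hom p d) (q1 : Hom q b) (q2 : Hom q d) :
  IsPullback f g p1 p2 -> IsPullback f g q1 q2 ->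
  exists theta : Hom p q, IsIso theta /\ q1 o theta = p1 /\ q2 o theta = p2.
Proof.
intros H K.
destruct (pb_lift K (pb_comm H)) as [t [T1 T2]].
destruct (pb_lift H (pb_comm K)) as [s [S1 S2]].
exists t. split; [exists s; split | auto].
- apply (pb_unique H); [rw S1; exact T1 | rw S2; exact T2].
- apply (pb_unique K); [rw T1; exact S1 | rw T2; exact S2].
Qed.

(** Makes vertical composition independent of the representatives of the two factors and of the
    result. *)
Lemma pb_change (b d b' d' c p p' : C) (f : Hom b c) (g : Hom d c)
  (f' : Hom b' c) (g' : Hom d' c) (p1 : Hom p b) (p2 : Hom p d)
  (alpha : Hom b b') (beta : Hom d d') (gamma : Hom p' p) :
  IsPullback f g p1 p2 -> IsIso alpha -> IsIso beta -> IsIso gamma ->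
  f' o alpha = f -> g' o beta = g ->
  IsPullback f' g' (alpha o p1 o gamma) (beta o p2 o gamma).
Proof.
intros H Ha Hb Hc <- <-. assert (E := pb_comm H). apply pb_intro.
- rw E. reflexivity.
- intros t h k F.
  destruct (pb_lift H (h := inv Ha o h) (k := inv Hb o k)) as [r [R1 R2]].
  + rw (inv_r Ha). rw (inv_r Hb). exact F.
  + exists (inv Hc o r). split.
    * rw (inv_r Hc). rw R1. rw (inv_r Ha). reflexivity.
    * rw (inv_r Hc). rw R2. rw (inv_r Hb). reflexivity.
- intros t r r' F G. apply (iso_mono Hc). apply (pb_unique H).
  + apply (iso_mono Ha). now rewrite !comp_assoc in *.
  + apply (iso_mono Hb). now rewrite !comp_assoc in *.
Qed.

Lemma pb_of_id_l (a c : C) (f : Hom a c) : IsPullback (idm c) f f (idm a).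
Proof.
apply pb_intro.
- now assoc.
- intros t h k E. exists k. rewrite comp_idl in E. now rewrite comp_idl.
- intros t r r' _ E. now rewrite !comp_idl in E.
Qed.

Lemma pb_of_iso_l (a b c : C) (phi : Hom b c) (f : Hom a c) (f' : Hom a b) :
  IsIso phi -> phi o f' = f -> IsPullback phi f f' (idm a).
Proof.
intros Hp E. apply pb_intro.
- now assoc.
- intros t h k F. exists k. rewrite comp_idl. split; [| reflexivity].
  apply (iso_mono Hp). rewrite comp_assoc. now rewrite E.
- intros t r r' _ F. now rewrite !comp_idl in F.
Qed.

Lemma pb_paste (y z d p q r : C) (h : Hom y d) (k : Hom z d)
  (p2 : Hom p y) (q1 : Hom q y) (q2 : Hom q z) (r1 : Hom r p) (r2 : Hom r q) :
  IsPullback h k q1 q2 -> IsPullback p2 q1 r1 r2 ->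
  IsPullback (h o p2) k r1 (q2 o r2).
Proof.
intros Q S. assert (EQ := pb_comm Q). assert (ES := pb_comm S). apply pb_intro.
- rw ES. rw EQ. reflexivity.
- intros t u v E. destruct (pb_lift Q (h := p2 o u) (k := v)) as [s [S1 S2]].
  + now rewrite comp_assoc.
  + destruct (pb_lift S (h := u) (k := s)) as [w [W1 W2]]; [now symmetry |].
    exists w. split; [exact W1 |]. rw W2. exact S2.
- intros t u v E1 E2. apply (pb_unique S); [exact E1 |].
  apply (pb_unique Q).
  + assoc. rewrite <- ES, <- !comp_assoc. now rewrite E1.
  + now rewrite !comp_assoc.
Qed.

(** For subobjects [n] and [n'] this says that inverse image along [i] preserves intersections. In
    [interchange], [i] is an injection into the composite middle row, and the result is a hypothesis
    of [po_restrict]. *)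
Lemma pb_intersect (w x p s s' r y y' : C) (i : Hom x p) (n : Hom s p)
  (n' : Hom s' p) (m : Hom y x) (m' : Hom y' x) (j : Hom y s) (j' : Hom y' s')
  (pi : Hom r s) (pi' : Hom r s') (a : Hom w y) (a' : Hom w y') (k : Hom w r) :
  IsPullback i n m j -> IsPullback i n' m' j' -> IsPullback n n' pi pi' ->
  IsPullback m m' a a' -> pi o k = j o a -> pi' o k = j' o a' ->
  IsPullback i (n o pi) (m o a) k.
Proof.
intros B B' R W E E'. assert (EB := pb_comm B). assert (EB' := pb_comm B').
assert (ER := pb_comm R). assert (EW := pb_comm W). apply pb_intro.
- rw E. rw EB. reflexivity.
- intros t h l F.
  destruct (pb_lift B (h := h) (k := pi o l)) as [u [U1 U2]].
  { now rewrite comp_assoc. }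
  destruct (pb_lift B' (h := h) (k := pi' o l)) as [u' [U1' U2']].
  { rewrite F. rw ER. reflexivity. }
  destruct (pb_lift W (h := u) (k := u')) as [v [V V']]; [congruence |].
  exists v. split.
  + rw V. exact U1.
  + apply (pb_unique R).
    * rw E. rw V. exact U2.
    * rw E'. rw V'. exact U2'.
- intros t u v F G. rewrite <- !comp_assoc in F. apply (pb_unique W).
  + apply (pb_unique B); [exact F |]. assoc. rewrite <- E, <- !comp_assoc.
    now rewrite G.
  + apply (pb_unique B').
    * assoc. rewrite <- EW, <- !comp_assoc. exact F.
    * assoc. rewrite <- E', <- !comp_assoc. now rewrite G.
Qed.

Lemma po_change (c x y x' y' p : C) (f : Hom c x) (g : Hom c y)
  (f' : Hom c x') (g' : Hom c y') (i1 : Hom x' p) (i2 : Hom y' p)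
  (alpha : Hom x x') (beta : Hom y y') :
  IsPushout f' g' i1 i2 -> IsIso alpha -> IsIso beta ->
  alpha o f = f' -> beta o g = g' -> IsPushout f g (i1 o alpha) (i2 o beta).
Proof.
intros H Ha Hb <- <-. assert (E := po_comm H). apply po_intro.
- now rewrite <- !comp_assoc.
- intros t h k F.
  destruct (po_desc H (h := h o inv Ha) (k := k o inv Hb)) as [r [R1 R2]].
  + rw (inv_l Ha). rw (inv_l Hb). exact F.
  + exists r. split.
    * rw R1. rw (inv_l Ha). reflexivity.
    * rw R2. rw (inv_l Hb). reflexivity.
- intros t r r' F G. apply (po_unique H).
  + apply (iso_epi Ha). now rewrite <- !comp_assoc.
  + apply (iso_epi Hb). now rewrite <- !comp_assoc.
Qed.

Lemma po_of_id_l (a b : C) (f : Hom a b) : IsPushout (idm a) f f (idm b).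
Proof.
apply po_intro.
- now assoc.
- intros t h k E. exists k. rewrite comp_idr in E. now rewrite comp_idr.
- intros t r r' _ E. now rewrite !comp_idr in E.
Qed.

Lemma po_of_id_r (a b : C) (f : Hom a b) : IsPushout f (idm a) (idm b) f.
Proof.
apply po_intro.
- now assoc.
- intros t h k E. exists h. rewrite comp_idr in E. now rewrite comp_idr.
- intros t r r' E _. now rewrite !comp_idr in E.
Qed.

End PullbackAndPushoutCalculus.

(** * Power objects *)

Inductive corner := left_end | right_end | middle.

Definition corner_hom (i j : corner) : Set :=
  match i, j with
  | left_end, left_end | right_end, right_end | middle, middle
  | left_end, middle | right_end, middle => unit
  | _, _ => Empty_set
  end.

Definition walking_cospan : Category.
Proof.
unshelve refine (@Build_Category corner corner_hom _ _ _ _ _).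
- now intros [].
- now intros [] [] [].
- now intros [] [] [].
- now intros [] [] [].
- now intros [] [] [] [].
Defined.

Lemma walking_cospan_finite : FiniteCategory walking_cospan.
Proof.
split.
- exists (cons left_end (cons right_end (cons middle nil))). intros []; simpl; auto.
- intros [] []; simpl;
    solve [exists (cons tt nil); intros []; simpl; auto | exists nil; intros []].
Qed.

Definition cospan_diagram (C : Category) (b d c : C) (f : Hom b c) (g : Hom d c) :
  Functor walking_cospan C.
Proof.
unshelve refine (@Build_Functor walking_cospan C
  (fun i => match i with left_end => b | right_end => d | middle => c end)
  _ _ _).
- intros [] [] u; solve [exact (idm _) | exact f | exact g | destruct u].
- now intros [].
- intros [] [] [] u v; try destruct u; try destruct v;
    simpl; now rewrite ?comp_idl, ?comp_idr.
Defined.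

Lemma pullback_exists (C : Category) (T : HasFiniteLimits C) (b d c : C)
  (f : Hom b c) (g : Hom d c) :
  exists p (p1 : Hom p b) (p2 : Hom p d), IsPullback f g p1 p2.
Proof.
destruct (T _ (cospan_diagram f g) walking_cospan_finite) as [K HK].
assert (E1 := @cone_nat _ _ _ K left_end middle tt).
assert (E2 := @cone_nat _ _ _ K right_end middle tt). simpl in E1, E2.
exists (cone_pt K), (cone_leg K left_end), (cone_leg K right_end).
split; [now rewrite E1, E2 |]. intros t h k E.
unshelve epose (K' := @Build_Cone walking_cospan C (cospan_diagram f g) t
  (fun i => match i with left_end => h | right_end => k | middle => f o h end) _).
{ intros [] [] u; try destruct u; simpl; now rewrite ?comp_idl. }
destruct (HK K') as [r [Hr U]]. exists r. split.
- split; [exact (Hr left_end) | exact (Hr right_end)].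
- intros r' [R1 R2]. apply U. intros []; simpl; [exact R1 | exact R2 |].
  rewrite <- R1, comp_assoc. now rewrite E1.
Qed.

(** * Products and equalizers *)

Section Topos.
Variables (C : Category) (T : IsTopos C).

Definition binprod (a b : C) : C :=
  proj1_sig (choose _ (has_products (topos_closed T) a b)).

Definition prod1 (a b : C) : Hom (binprod a b) a :=
  proj1_sig (choose _ (proj2_sig (choose _ (has_products (topos_closed T) a b)))).

Definition prod2 (a b : C) : Hom (binprod a b) b :=
  proj1_sig (choose _ (proj2_sig (choose _
    (proj2_sig (choose _ (has_products (topos_closed T) a b)))))).

Lemma binprod_product (a b : C) : IsProduct (prod1 a b) (prod2 a b).
Proof.
exact (proj2_sig (choose _ (proj2_sig (choose _
    (proj2_sig (choose _ (has_products (topos_closed T) a b))))))).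
Qed.

Lemma pair_exists (t a b : C) (f : Hom t a) (g : Hom t b) :
  exists h, prod1 a b o h = f /\ prod2 a b o h = g.
Proof.
destruct (binprod_product f g) as [h [H _]]. now exists h.
Qed.

Definition pair (t a b : C) (f : Hom t a) (g : Hom t b) : Hom t (binprod a b) :=
  proj1_sig (choose _ (pair_exists f g)).

Lemma prod1_pair (t a b : C) (f : Hom t a) (g : Hom t b) :
  prod1 a b o pair f g = f.
Proof. exact (proj1 (proj2_sig (choose _ (pair_exists f g)))). Qed.

Lemma prod2_pair (t a b : C) (f : Hom t a) (g : Hom t b) :
  prod2 a b o pair f g = g.
Proof. exact (proj2 (proj2_sig (choose _ (pair_exists f g)))). Qed.

Lemma prod_ext (t a b : C) (h k : Hom t (binprod a b)) :
  prod1 a b o h = prod1 a b o k -> prod2 a b o h = prod2 a b o k -> h = k.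
Proof.
intros E1 E2.
destruct (binprod_product (prod1 a b o h) (prod2 a b o h)) as [l [_ U]].
rewrite <- (U h), <- (U k); auto.
Qed.

Lemma pair_comp (s t a b : C) (f : Hom t a) (g : Hom t b) (k : Hom s t) :
  pair f g o k = pair (f o k) (g o k).
Proof.
apply prod_ext; rewrite comp_assoc, ?prod1_pair, ?prod2_pair; reflexivity.
Qed.

(** The equalizer is the pullback of the graphs of [f] and [g]; its two projections to [x] coincide,
    by comparing first components. *)
Lemma equalizer_exists (x y : C) (f g : Hom x y) :
  exists e (m : Hom e x), Mono m /\
    forall d (z : Hom d x), f o z = g o z <-> exists w, m o w = z.
Proof.
destruct (pullback_exists (topos_limits T) (pair (idm x) f) (pair (idm x) g))
  as [e [m [m' P]]].
assert (E : m = m').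
{ assert (E := f_equal (fun z => prod1 _ _ o z) (pb_comm P)). simpl in E.
  now rewrite !comp_assoc, !prod1_pair, !comp_idl in E. }
subst m'. exists e, m. split.
- intros d z z' H. exact (pb_unique P H H).
- intros d z. split.
  + intros H. destruct (pb_lift P (h := z) (k := z)) as [w [W _]].
    * rewrite !pair_comp. now rewrite H.
    * now exists w.
  + intros [w W]. subst z.
    assert (E := f_equal (fun z => prod2 _ _ o z) (pb_comm P)). simpl in E.
    rewrite !comp_assoc, !prod2_pair in E. now rewrite !comp_assoc, E.
Qed.

(** * The subobject classifier in terms of generalized elements *)

Definition terminal : C := proj1_sig (choose _ (topos_classifier T)).

Definition Omega : C :=
  proj1_sig (choose _ (proj2_sig (choose _ (topos_classifier T)))).

Definition generic_truth : Hom terminal Omega :=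
  proj1_sig (choose _ (proj2_sig (choose _
    (proj2_sig (choose _ (topos_classifier T)))))).

Lemma classifier_spec : IsTerminal terminal /\
  forall (s x : C) (m : Hom s x), Mono m ->
    exists! chi : Hom x Omega,
      exists k : Hom s terminal, IsPullback chi generic_truth m k.
Proof.
exact (proj2_sig (choose _ (proj2_sig (choose _
    (proj2_sig (choose _ (topos_classifier T))))))).
Qed.

Lemma to_terminal_exists (d : C) : exists f : Hom d terminal, True.
Proof. destruct (proj1 classifier_spec d) as [f _]. now exists f. Qed.

Lemma to_terminal_unique (d : C) (f g : Hom d terminal) : f = g.
Proof.
destruct (proj1 classifier_spec d) as [h [_ U]]. now rewrite <- (U f), <- (U g).
Qed.

Definition truth (d : C) : Hom d Omega :=
  generic_truth o proj1_sig (choose _ (to_terminal_exists d)).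

Lemma truth_comp (d d' : C) (k : Hom d' d) : truth d o k = truth d'.
Proof.
unfold truth. rewrite <- comp_assoc. f_equal. apply to_terminal_unique.
Qed.

(** The pullback square is replaced by a membership test on generalized elements, the form in which
    all later arguments use it. *)
Lemma classify (s x : C) (m : Hom s x) : Mono m ->
  exists chi : Hom x Omega,
    forall d (y : Hom d x), chi o y = truth d <-> exists z, m o z = y.
Proof.
intros Hm. destruct (proj2 classifier_spec _ _ _ Hm) as [chi [[k P] _]].
exists chi. intros d y. split.
- intros E. destruct (pb_lift P E) as [r [R _]]. now exists r.
- intros [z Z]. subst y. rw (pb_comm P). unfold truth. rewrite <- comp_assoc.
  f_equal. apply to_terminal_unique.
Qed.

(** The subobject on which [chi] is true is also a pullback of [generic_truth] along [chi'], so
    uniqueness of classifiers applies. *)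
Lemma omega_ext (x : C) (chi chi' : Hom x Omega) :
  (forall d (y : Hom d x), chi o y = truth d <-> chi' o y = truth d) -> chi = chi'.
Proof.
intros H.
destruct (pullback_exists (topos_limits T) chi generic_truth) as [s [m [k P]]].
assert (Hm : Mono m).
{ intros d z z' E. apply (pb_unique P E), to_terminal_unique. }
destruct (proj2 classifier_spec _ _ _ Hm) as [c [_ U]].
rewrite <- (U chi) by now exists k. apply U. exists k. apply pb_intro.
- assert (E : chi' o m = truth s).
  { apply H. rewrite (pb_comm P). unfold truth. f_equal. apply to_terminal_unique. }
  rewrite E. unfold truth. f_equal. apply to_terminal_unique.
- intros t h l E. destruct (pb_lift P (h := h) (k := l)) as [r R].
  + assert (E' : chi o h = truth t).
    { apply H. rewrite E. unfold truth. f_equal. apply to_terminal_unique. }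
    rewrite E'. unfold truth. f_equal. apply to_terminal_unique.
  + now exists r.
- exact (pb_unique P).
Qed.

(** * Power objects and their internal language *)

Lemma power_exists (b : C) : exists (e : C) (ev : Hom (binprod e b) Omega),
  forall (d : C) (f : Hom (binprod d b) Omega), exists! g : Hom d e,
    ev o pair (g o prod1 d b) (prod2 d b) = f.
Proof.
destruct (has_exponentials (topos_closed T) b Omega)
  as [e [q [q1 [q2 [ev [Q H]]]]]].
(* [j] compares the chosen product with the one that comes with the exponential; by [K], the arrow
   [h] in [IsExponential] is then an explicit pairing. *)
destruct (Q _ (prod1 e b) (prod2 e b)) as [j [[J1 J2] _]].
exists e, (ev o j). intros d f.
assert (K : forall g h : Hom _ _, q1 o h = g o prod1 d b /\ q2 o h = prod2 d b <->
                      h = j o pair (g o prod1 d b) (prod2 d b)).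
{ intros g h. split.
  - intros [E1 E2]. destruct (Q _ (g o prod1 d b) (prod2 d b)) as [l [_ U]].
    rewrite <- (U h) by auto. apply U.
    rewrite !comp_assoc, J1, J2, prod1_pair, prod2_pair. auto.
  - intros ->. rewrite !comp_assoc, J1, J2, prod1_pair, prod2_pair. auto. }
destruct (H _ _ _ _ (@binprod_product d b) f) as [g [[h [H1 [H2 H3]]] U]].
exists g. split.
- rewrite <- H3, <- comp_assoc. f_equal. symmetry. now apply K.
- intros g' E. apply U. exists (j o pair (g' o prod1 d b) (prod2 d b)).
  destruct (proj2 (K g' _) eq_refl) as [E1 E2]. repeat split; auto.
  now rewrite comp_assoc.
Qed.

Definition power (b : C) : C := proj1_sig (choose _ (power_exists b)).

Definition power_ev (b : C) : Hom (binprod (power b) b) Omega :=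
  proj1_sig (choose _ (proj2_sig (choose _ (power_exists b)))).

Lemma power_spec (b d : C) (f : Hom (binprod d b) Omega) :
  exists! g : Hom d (power b), power_ev b o pair (g o prod1 d b) (prod2 d b) = f.
Proof.
exact (proj2_sig (choose _ (proj2_sig (choose _ (power_exists b)))) d f).
Qed.

(* The truth value of [y \in S], for generalized elements [S] of [power b] and
   [y] of [b]. *)
Definition holds (d b : C) (S : Hom d (power b)) (y : Hom d b) : Hom d Omega :=
  power_ev b o pair S y.

Lemma holds_comp (d d' b : C) (S : Hom d (power b)) (y : Hom d b) (k : Hom d' d) :
  holds S y o k = holds (S o k) (y o k).
Proof. unfold holds. rewrite <- comp_assoc. now rewrite pair_comp. Qed.

(** Extensionality: it is enough to test on the generic element, the second projection at stage
    [binprod d b]. *)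
Lemma power_ext (d b : C) (S S' : Hom d (power b)) :
  (forall d' (k : Hom d' d) (y : Hom d' b), holds (S o k) y = holds (S' o k) y) ->
  S = S'.
Proof.
intros H. destruct (power_spec (holds (S o prod1 d b) (prod2 d b))) as [g [_ U]].
rewrite <- (U S) by reflexivity. apply U. symmetry. apply H.
Qed.

Lemma comprehension (d b : C) (f : Hom (binprod d b) Omega) :
  exists S : Hom d (power b),
    forall d' (k : Hom d' d) (y : Hom d' b), holds (S o k) y = f o pair k y.
Proof.
destruct (power_spec f) as [g [E _]]. exists g. intros d' k y. subst f.
unfold holds. rewrite <- comp_assoc. f_equal.
rewrite pair_comp, <- comp_assoc. now rewrite prod1_pair, prod2_pair.
Qed.

(** Inverse image along [u]. It is applied to the generic family, the identity of [power b], and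
    then yields the contravariant action of [u] on power objects. *)
Lemma transpose_exists (d a b : C) (S : Hom d (power b)) (u : Hom a b) :
  exists S' : Hom d (power a), forall d' (k : Hom d' d) (y : Hom d' a),
    holds (S' o k) y = holds (S o k) (u o y).
Proof.
destruct (comprehension (holds (S o prod1 d a) (u o prod2 d a))) as [S' H].
exists S'. intros d' k y. rewrite H, holds_comp, <- !comp_assoc.
now rewrite prod1_pair, prod2_pair.
Qed.

Lemma ultrafilter_exists (t : C) : exists eta : Hom t (power (power t)),
  forall d (a : Hom d t) (U : Hom d (power t)), holds (eta o a) U = holds U a.
Proof.
destruct (comprehension (holds (prod2 t (power t)) (prod1 t (power t)))) as [eta H].
exists eta. intros d a U. rewrite H, holds_comp. now rewrite prod1_pair, prod2_pair.
Qed.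

Definition ultrafilter (t : C) : Hom t (power (power t)) :=
  proj1_sig (choose _ (ultrafilter_exists t)).

Lemma holds_ultrafilter (t d : C) (a : Hom d t) (U : Hom d (power t)) :
  holds (ultrafilter t o a) U = holds U a.
Proof. exact (proj2_sig (choose _ (ultrafilter_exists t)) d a U). Qed.

(* An ultrafilter determines its point because it contains the singleton of the
   point. *)
Lemma ultrafilter_mono (t : C) : Mono (ultrafilter t).
Proof.
intros d a b E.
assert (Hm : Mono (pair (idm t) (idm t))).
{ intros e y z H. apply (f_equal (fun w => prod1 t t o w)) in H.
  now rewrite !comp_assoc, !prod1_pair, !comp_idl in H. }
destruct (classify Hm) as [delta D].
destruct (comprehension delta) as [singleton S].
assert (H : delta o pair a b = truth d).
{ rewrite <- S, <- holds_ultrafilter, <- E, holds_ultrafilter, S. apply D.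
  exists a. now rewrite pair_comp, comp_idl. }
apply D in H. destruct H as [z Z]. rewrite pair_comp, comp_idl in Z.
assert (E1 := f_equal (fun w => prod1 t t o w) Z).
assert (E2 := f_equal (fun w => prod2 t t o w) Z). simpl in E1, E2.
rewrite !prod1_pair in E1. rewrite !prod2_pair in E2. congruence.
Qed.

(* The intersection of all subobjects of [y] containing the images of [i] and
   [i'], formed as the intersection of a family indexed by a subobject of
   [power y]. *)
Lemma hull_exists (x x' y : C) (i : Hom x y) (i' : Hom x' y) :
  exists p (m : Hom p y), Mono m /\
    (exists z, m o z = i) /\ (exists z, m o z = i') /\
    forall s (n : Hom s y), Mono n ->
      (exists z, n o z = i) -> (exists z, n o z = i') -> exists z, n o z = m.
Proof.
destruct (transpose_exists (idm (power y)) i) as [r R].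
destruct (transpose_exists (idm (power y)) i') as [r' R'].
(* [t] and [t'] are constant, with value all of [x] and all of [x']. Agreement of [r] with [t] and
   of [r'] with [t'] thus singles out the subobjects of [y] that contain both images; they form
   [b]. *)
destruct (comprehension (truth (binprod (power y) x))) as [t Ht].
destruct (comprehension (truth (binprod (power y) x'))) as [t' Ht'].
destruct (equalizer_exists r t) as [b1 [e1 [_ E1]]].
destruct (equalizer_exists (r' o e1) (t' o e1)) as [b [e2 [_ E2]]].
pose (e := e1 o e2).
(* [rho] sends a point of [y] to the set of members of the family that contain it, and [tau] is
   constantly the whole family; they agree exactly on the intersection. *)
destruct (comprehension (holds (e o prod2 y b) (prod1 y b))) as [rho Rho].
destruct (comprehension (truth (binprod y b))) as [tau Tau].
destruct (equalizer_exists rho tau) as [p [m [Hm M]]].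
assert (In : forall d (z : Hom d y),
          (forall d' (k : Hom d' d) (w : Hom d' b), holds (e o w) (z o k) = truth d')
          -> exists v, m o v = z).
{ intros d z H. apply M. apply power_ext. intros d' k w.
  rewrite <- !comp_assoc, Rho, Tau, holds_comp, truth_comp.
  rewrite <- !comp_assoc, prod1_pair, prod2_pair. apply H. }
exists p, m. split; [exact Hm |]. split; [| split].
- apply In. intros d k w.
  assert (E : r o (e o w) = t o (e o w)).
  { unfold e. rewrite <- (comp_assoc e1). apply E1. now exists (e2 o w). }
  rewrite <- (truth_comp (pair (e o w) k)), <- Ht, <- E, R. now rewrite comp_idl.
- apply In. intros d k w.
  assert (E : r' o (e o w) = t' o (e o w)).
  { unfold e. rewrite !comp_assoc. f_equal. apply E2. exists (idm _). apply comp_idr. }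
  rewrite <- (truth_comp (pair (e o w) k)), <- Ht', <- E, R'. now rewrite comp_idl.
- intros s n Hn [z Z] [z' Z']. destruct (classify Hn) as [chi Chi].
  (* [n] itself becomes a global element of [power y]. It factors through [b], so the intersection
     is contained in it. *)
  destruct (comprehension (chi o prod2 terminal y)) as [name Name].
  assert (Hname : forall d (k : Hom d terminal) (u : Hom d y),
             holds (name o k) u = chi o u).
  { intros d k u. rewrite Name, <- comp_assoc. now rewrite prod2_pair. }
  assert (B : exists w, e o w = name).
  { destruct (proj1 (E1 _ name)) as [w1 W1].
    - apply power_ext. intros d k u.
      rewrite <- !comp_assoc, R, Ht, comp_idl, Hname, truth_comp. apply Chi.
      exists (z o u). rewrite comp_assoc. now rewrite Z.
    - destruct (proj1 (E2 _ w1)) as [w W].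
      + rewrite <- !comp_assoc, W1. apply power_ext. intros d k u.
        rewrite <- !comp_assoc, R', Ht', comp_idl, Hname, truth_comp. apply Chi.
        exists (z' o u). rewrite comp_assoc. now rewrite Z'.
      + exists w. unfold e. rewrite <- comp_assoc. now rewrite W. }
  destruct B as [w W].
  apply Chi. destruct (to_terminal_exists p) as [k _].
  rewrite <- (Hname p k). rewrite <- W.
  rewrite <- (comp_assoc e w k).
  assert (E : rho o m = tau o m) by (apply M; exists (idm _); apply comp_idr).
  assert (F := f_equal (fun g => holds (g o idm p) (w o k)) E). cbv beta in F.
  rewrite <- !comp_assoc, Rho, Tau, holds_comp, truth_comp in F.
  rewrite <- !comp_assoc, prod1_pair, prod2_pair, comp_idr in F. exact F.
Qed.

(* Elements of the pushout are the ultrafilters on the object [q] of pairs of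
   subobjects of [x] and [x'] with the same inverse image in [c] that lie in the
   hull of [x] and [x']. *)
Theorem pushout_exists (c x x' : C) (f : Hom c x) (g : Hom c x') :
  exists p (i1 : Hom x p) (i2 : Hom x' p), IsPushout f g i1 i2.
Proof.
destruct (transpose_exists (idm (power x)) f) as [f' F].
destruct (transpose_exists (idm (power x')) g) as [g' G].
destruct (pullback_exists (topos_limits T) f' g') as [q [q1 [q2 Q]]].
(* [j] sends a point of [x] to the set of pairs whose first component contains it; [j'] does the
   same for [x'] with the second component. *)
destruct (comprehension (holds (q1 o prod2 x q) (prod1 x q))) as [j J].
destruct (comprehension (holds (q2 o prod2 x' q) (prod1 x' q))) as [j' J'].
assert (J1 : forall d (k : Hom d x) w, holds (j o k) w = holds (q1 o w) k).
{ intros d k w. rewrite J, holds_comp, <- !comp_assoc.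
  now rewrite prod1_pair, prod2_pair. }
assert (J2 : forall d (k : Hom d x') w, holds (j' o k) w = holds (q2 o w) k).
{ intros d k w. rewrite J', holds_comp, <- !comp_assoc.
  now rewrite prod1_pair, prod2_pair. }
destruct (hull_exists j j') as [p [m [Hm [[i1 I1] [[i2 I2] Hull]]]]].
exists p, i1, i2. apply po_intro.
- apply Hm. rewrite !comp_assoc, I1, I2. apply power_ext. intros d k w.
  rewrite <- !comp_assoc, J1, J2.
  rewrite <- (comp_idl (q1 o w)), <- (comp_idl (q2 o w)), <- F, <- G.
  rewrite !comp_assoc. now rewrite (pb_comm Q).
- intros t h k E.
  destruct (transpose_exists (idm (power t)) h) as [h' H].
  destruct (transpose_exists (idm (power t)) k) as [k' K].
  destruct (pb_lift Q (h := h') (k := k')) as [u [U1 U2]].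
  { apply power_ext. intros d l y.
    rewrite <- !comp_assoc, F, G, !comp_idl, H, K, !comp_assoc. now rewrite E. }
  (* [u] sends a subobject of [t] to its inverse images along [h] and [k], and [u'] is inverse image
     along [u]. It sends the ultrafilter of a point of [x] to that of its value under [h]. Points of
     [power q] that [u'] sends to principal ultrafilters thus form a subobject containing both
     images, hence the hull. *)
  destruct (transpose_exists (idm (power q)) u) as [u' U'].
  assert (V1 : u' o j = ultrafilter t o h).
  { apply power_ext. intros d l w.
    rewrite <- !comp_assoc, U', comp_idl, J1, holds_ultrafilter, comp_assoc, U1, H.
    now rewrite comp_idl. }
  assert (V2 : u' o j' = ultrafilter t o k).
  { apply power_ext. intros d l w.
    rewrite <- !comp_assoc, U', comp_idl, J2, holds_ultrafilter, comp_assoc, U2, K.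
    now rewrite comp_idl. }
  destruct (pullback_exists (topos_limits T) u' (ultrafilter t)) as [s [n [r S]]].
  destruct (Hull s n) as [v V].
  + exact (pb_mono_l S (@ultrafilter_mono t)).
  + destruct (pb_lift S V1) as [z [Z _]]. now exists z.
  + destruct (pb_lift S V2) as [z [Z _]]. now exists z.
  + exists (r o v). split; apply (@ultrafilter_mono t); assoc;
      rewrite <- (pb_comm S); rw V; [rw I1 | rw I2]; assumption.
- intros t r r' E1 E2.
  destruct (equalizer_exists r r') as [s [n [Hn N]]].
  destruct (Hull s (m o n)) as [z Z].
  + now apply mono_comp.
  + destruct (proj1 (N _ i1) E1) as [w W]. exists w. rw W. exact I1.
  + destruct (proj1 (N _ i2) E2) as [w W]. exists w. rw W. exact I2.
  + assert (W : n o z = idm p) by (apply Hm; assoc; exact Z).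
    rewrite <- (comp_idr r), <- (comp_idr r'). apply N. now exists z.
Qed.

(** * Pushouts and monomorphisms *)

(* A classifier on a pushout is determined by its restrictions. *)
Lemma po_subobject_iso (c x x' p s e : C) (f : Hom c x) (g : Hom c x')
  (i1 : Hom x p) (i2 : Hom x' p) (n : Hom s p) (m : Hom e s) :
  IsPushout f g i1 i2 -> Mono n -> Mono m ->
  (forall d (y : Hom d x) z, n o z = i1 o y -> exists w, m o w = z) ->
  (forall d (y : Hom d x') z, n o z = i2 o y -> exists w, m o w = z) ->
  IsIso m.
Proof.
intros P Hn Hm H1 H2.
destruct (classify Hn) as [chi Chi].
destruct (classify (mono_comp Hn Hm)) as [psi Psi].
assert (E : chi = psi).
{ apply (po_unique P); apply omega_ext; intros d y; rewrite <- !comp_assoc;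
    rewrite Chi, Psi; split.
  - intros [z Z]. destruct (H1 _ _ _ Z) as [w W]. exists w. rw W. exact Z.
  - intros [w W]. exists (m o w). now rewrite comp_assoc.
  - intros [z Z]. destruct (H2 _ _ _ Z) as [w W]. exists w. rw W. exact Z.
  - intros [w W]. exists (m o w). now rewrite comp_assoc. }
destruct (proj1 (Psi _ n)) as [z Z].
{ rewrite <- E. apply Chi. exists (idm s). apply comp_idr. }
apply (mono_section (z := z) Hm). apply Hn. assoc. exact Z.
Qed.

(* To descend [h] and [k] to [s], extend the families of subobjects [h^-1 U] of
   [w] and [k^-1 U] of [w'] to families of subobjects of [x] and [x'].  They agree
   on [c], hence define a map from [p] to [power (power t)], whose restriction
   to [s] takes values in principal ultrafilters. *)
Lemma po_restrict (c c0 x x' p s w w' : C) (f : Hom c x) (g : Hom c x')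
  (i1 : Hom x p) (i2 : Hom x' p) (n : Hom s p) (m : Hom w x) (m' : Hom w' x')
  (j1 : Hom w s) (j2 : Hom w' s) (sigma : Hom c0 c) (f0 : Hom c0 w)
  (g0 : Hom c0 w') :
  IsPushout f g i1 i2 -> Mono n ->
  IsPullback i1 n m j1 -> IsPullback i2 n m' j2 -> IsIso sigma ->
  m o f0 = f o sigma -> m' o g0 = g o sigma -> IsPushout f0 g0 j1 j2.
Proof.
intros P Hn B1 B2 Hs F G.
(* [j1] and [j2] jointly cover [s]. Existence of the descended arrow applies this to the locus where
   values are principal ultrafilters, uniqueness to an equalizer. *)
assert (Sub : forall e (k : Hom e s), Mono k ->
          (exists z, k o z = j1) -> (exists z, k o z = j2) -> IsIso k).
{ intros e k Hk [z1 Z1] [z2 Z2]. apply (po_subobject_iso P Hn Hk).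
  - intros d y z E. destruct (pb_lift B1 (eq_sym E)) as [r [_ R]].
    exists (z1 o r). rw Z1. exact R.
  - intros d y z E. destruct (pb_lift B2 (eq_sym E)) as [r [_ R]].
    exists (z2 o r). rw Z2. exact R. }
apply po_intro.
- apply Hn. assoc. rewrite <- (pb_comm B1), <- (pb_comm B2).
  rw F. rw G. now rewrite (po_comm P).
- intros t h k E.
  (* [b] sends [y0] to the set of those [U] for which [y0] lies in [v] with value under [a] in [U].
     It classifies the pairs in [v] times [power t] with this property, seen as pairs in [y] times
     [power t]; on [v] it is the principal ultrafilter at [a]. *)
  assert (Ext : forall (v y : C) (l : Hom v y) (a : Hom v t), Mono l ->
    exists b : Hom y (power (power t)), forall d (y0 : Hom d y) (U : Hom d (power t)),
      holds (b o y0) U = truth d <->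
      exists z, l o z = y0 /\ holds U (a o z) = truth d).
  { intros v y l a Hl.
    destruct (equalizer_exists (holds (prod2 v (power t)) (a o prod1 v (power t)))
                (truth _)) as [u [e [He Eq]]].
    assert (Hp : Mono (pair (l o prod1 v (power t)) (prod2 v (power t)))).
    { intros d z z' H.
      assert (H1 := f_equal (fun w => prod1 _ _ o w) H).
      assert (H2 := f_equal (fun w => prod2 _ _ o w) H). cbv beta in H1, H2.
      rewrite !comp_assoc, !prod1_pair in H1. rewrite !comp_assoc, !prod2_pair in H2.
      apply prod_ext; [apply Hl; now rewrite !comp_assoc | exact H2]. }
    destruct (classify (mono_comp Hp He)) as [chi Chi].
    destruct (comprehension chi) as [b B]. exists b. intros d y0 U.
    rewrite B, Chi. split.
    - intros [z Z]. rewrite !pair_comp in Z.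
      assert (H1 := f_equal (fun w => prod1 _ _ o w) Z).
      assert (H2 := f_equal (fun w => prod2 _ _ o w) Z). cbv beta in H1, H2.
      rewrite !prod1_pair in H1. rewrite !prod2_pair in H2.
      exists (prod1 _ _ o e o z). split; [now rewrite <- H1, !comp_assoc |].
      rewrite <- H2. rewrite <- (truth_comp (e o z)).
      transitivity (holds (prod2 v (power t)) (a o prod1 v (power t)) o (e o z)).
      + now rewrite holds_comp, !comp_assoc.
      + apply Eq. now exists z.
    - intros [z [Z1 Z2]]. destruct (proj1 (Eq _ (pair z U))) as [r R].
      + rewrite holds_comp, truth_comp, <- comp_assoc. now rewrite prod1_pair, prod2_pair.
      + exists r. rewrite <- comp_assoc, R, pair_comp, <- comp_assoc.
        rewrite prod1_pair, prod2_pair. now rewrite Z1. }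
  destruct (Ext _ _ m h) as [b B].
  { exact (pb_mono_l B1 Hn). }
  destruct (Ext _ _ m' k) as [b' B'].
  { exact (pb_mono_l B2 Hn). }
  assert (Hm := pb_mono_l B1 Hn). assert (Hm' := pb_mono_l B2 Hn).
  assert (Bm : b o m = ultrafilter t o h).
  { apply power_ext. intros d l U. apply omega_ext. intros d' l'.
    rewrite !holds_comp, <- !comp_assoc, holds_ultrafilter, B. split.
    - intros [z [Z1 Z2]]. apply Hm in Z1. now subst z.
    - intros H. now exists (l o l'). }
  assert (Bm' : b' o m' = ultrafilter t o k).
  { apply power_ext. intros d l U. apply omega_ext. intros d' l'.
    rewrite !holds_comp, <- !comp_assoc, holds_ultrafilter, B'. split.
    - intros [z [Z1 Z2]]. apply Hm' in Z1. now subst z.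
    - intros H. now exists (l o l'). }
  destruct (po_desc P (h := b) (k := b')) as [r [R1 R2]].
  { apply (iso_epi Hs). rewrite <- !comp_assoc, <- F, <- G, !comp_assoc, Bm, Bm'.
    rewrite <- !comp_assoc. now rewrite E. }
  destruct (pullback_exists (topos_limits T) (r o n) (ultrafilter t))
    as [e [l [v V]]].
  assert (N1 : r o n o j1 = ultrafilter t o h).
  { rewrite <- comp_assoc, <- (pb_comm B1), comp_assoc. now rewrite R1. }
  assert (N2 : r o n o j2 = ultrafilter t o k).
  { rewrite <- comp_assoc, <- (pb_comm B2), comp_assoc. now rewrite R2. }
  destruct (Sub e l) as [l' [_ L]].
  + exact (pb_mono_l V (@ultrafilter_mono t)).
  + destruct (pb_lift V N1) as [z [Z _]]. now exists z.
  + destruct (pb_lift V N2) as [z [Z _]]. now exists z.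
  + exists (v o l'). split; apply (@ultrafilter_mono t); assoc;
      rewrite <- (pb_comm V); rw L; assumption.
- intros t r r' E1 E2.
  destruct (equalizer_exists r r') as [e [k [Hk K]]].
  destruct (Sub e k Hk (proj1 (K _ _) E1) (proj1 (K _ _) E2)) as [z [_ Z]].
  rewrite <- (comp_idr r), <- (comp_idr r'). apply K. now exists z.
Qed.

(* The classifiers of [m] and [m'] are both true on [c], hence induce the
   classifier of a subobject of [p] restricting to [m] and [m']. *)
Lemma po_mono (c c0 x x' p q w w' : C) (f : Hom c x) (g : Hom c x')
  (i1 : Hom x p) (i2 : Hom x' p) (n : Hom q p) (m : Hom w x) (m' : Hom w' x')
  (k1 : Hom w q) (k2 : Hom w' q) (sigma : Hom c0 c) (f0 : Hom c0 w)
  (g0 : Hom c0 w') :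
  IsPushout f g i1 i2 -> IsPushout f0 g0 k1 k2 -> Mono m -> Mono m' ->
  IsIso sigma -> m o f0 = f o sigma -> m' o g0 = g o sigma ->
  n o k1 = i1 o m -> n o k2 = i2 o m' ->
  Mono n /\ IsPullback i1 n m k1 /\ IsPullback i2 n m' k2.
Proof.
intros P Q Hm Hm' Hs F G N1 N2.
destruct (classify Hm) as [chi Chi]. destruct (classify Hm') as [psi Psi].
destruct (po_desc P (h := chi) (k := psi)) as [phi [Phi1 Phi2]].
{ apply (iso_epi Hs). rewrite <- !comp_assoc, <- F, <- G.
  transitivity (truth c0); [apply Chi | symmetry; apply Psi]; eauto. }
destruct (equalizer_exists phi (truth p)) as [s [l [Hl S]]].
assert (L : forall d (z : Hom d p), phi o z = truth d <-> exists y, l o y = z).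
{ intros d z. rewrite <- S, truth_comp. reflexivity. }
destruct (proj1 (L _ (i1 o m))) as [j1 J1].
{ rewrite comp_assoc, Phi1. apply Chi. exists (idm w). apply comp_idr. }
destruct (proj1 (L _ (i2 o m'))) as [j2 J2].
{ rewrite comp_assoc, Phi2. apply Psi. exists (idm w'). apply comp_idr. }
assert (B1 : IsPullback i1 l m j1).
{ apply pb_intro.
  - now symmetry.
  - intros t h k E. destruct (proj1 (Chi _ h)) as [z Z].
    + rewrite <- Phi1, <- comp_assoc. apply L. exists k. now symmetry.
    + exists z. split; [exact Z |]. apply Hl. rw J1. rw Z. exact E.
  - intros t r r' E _. now apply Hm. }
assert (B2 : IsPullback i2 l m' j2).
{ apply pb_intro.
  - now symmetry.
  - intros t h k E. destruct (proj1 (Psi _ h)) as [z Z].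
    + rewrite <- Phi2, <- comp_assoc. apply L. exists k. now symmetry.
    + exists z. split; [exact Z |]. apply Hl. rw J2. rw Z. exact E.
  - intros t r r' E _. now apply Hm'. }
(* The subobject [s] classified by [phi] is therefore itself a pushout of [w] and [w'], which
   identifies [n] with [l] up to an isomorphism. *)
assert (K := po_restrict P Hl B1 B2 Hs F G).
destruct (po_iso Q K) as [theta [Ht [T1 T2]]].
assert (N : n = l o theta).
{ apply (po_unique Q); [rw T1; now rewrite J1 | rw T2; now rewrite J2]. }
assert (Hn : Mono n) by (subst n; apply mono_comp; [exact Hl | now apply iso_mono]).
split; [exact Hn |]. split.
- apply pb_intro.
  + now symmetry.
  + intros t h k E. destruct (pb_lift B1 (h := h) (k := theta o k)) as [r [R1 R2]].
    * rewrite comp_assoc. now rewrite <- N.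
    * exists r. split; [exact R1 |]. apply Hn. rw N1. rw R1. exact E.
  + intros t r r' E _. now apply Hm.
- apply pb_intro.
  + now symmetry.
  + intros t h k E. destruct (pb_lift B2 (h := h) (k := theta o k)) as [r [R1 R2]].
    * rewrite comp_assoc. now rewrite <- N.
    * exists r. split; [exact R1 |]. apply Hn. rw N2. rw R1. exact E.
  + intros t r r' E _. now apply Hm'.
Qed.

End Topos.

(** * Strict composition of invertible spans *)

Section VerticalArrows.
Variable A : Category.

Definition Isom (a b : A) : Type := { f : Hom a b | IsIso f }.

Lemma isom_ext (a b : A) (f g : Isom a b) : proj1_sig f = proj1_sig g -> f = g.
Proof.
destruct f as [f Hf], g as [g Hg]. simpl. intros ->. f_equal.
apply proof_irrelevance.
Qed.

Definition isom_id (a : A) : Isom a a := exist _ (idm a) (iso_id a).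

Definition isom_comp (a b c : A) (g : Isom b c) (f : Isom a b) : Isom a c :=
  exist _ (proj1_sig g o proj1_sig f) (iso_comp (proj2_sig g) (proj2_sig f)).

Definition isom_inv (a b : A) (f : Isom a b) : Isom b a :=
  exist _ (inv (proj2_sig f)) (iso_inv (proj2_sig f)).

Lemma isom_idl (a b : A) (f : Isom a b) : isom_comp (isom_id b) f = f.
Proof. apply isom_ext, comp_idl. Qed.

Lemma isom_idr (a b : A) (f : Isom a b) : isom_comp f (isom_id a) = f.
Proof. apply isom_ext, comp_idr. Qed.

Lemma isom_assoc (a b c d : A) (h : Isom c d) (g : Isom b c) (f : Isom a b) :
  isom_comp h (isom_comp g f) = isom_comp (isom_comp h g) f.
Proof. apply isom_ext, comp_assoc. Qed.

Lemma isom_inv_l (a b : A) (f : Isom a b) : isom_comp (isom_inv f) f = isom_id a.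
Proof. apply isom_ext, inv_l. Qed.

Lemma isom_inv_r (a b : A) (f : Isom a b) : isom_comp f (isom_inv f) = isom_id b.
Proof. apply isom_ext, inv_r. Qed.

(** [epsilon] depends only on its predicate, and isomorphic objects have equal predicates by
    extensionality; hence they share one representative, as [repr_eq] states. *)
Definition repr (a : A) : A := epsilon (inhabits a) (fun b => inhabited (Isom a b)).

Lemma repr_isom (a : A) : inhabited (Isom a (repr a)).
Proof.
unfold repr. apply epsilon_spec. exists a. exact (inhabits (isom_id a)).
Qed.

Lemma repr_eq (a b : A) (f : Isom a b) : repr b = repr a.
Proof.
unfold repr.
replace (fun d => inhabited (Isom b d)) with (fun d => inhabited (Isom a d)).
- f_equal. apply proof_irrelevance.
- apply functional_extensionality. intros d. apply propositional_extensionality.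
  split; intros [g]; constructor.
  + exact (isom_comp g (isom_inv f)).
  + exact (isom_comp g f).
Qed.

Definition to_repr (a : A) : Isom a (repr a) := epsilon (repr_isom a) (fun _ => True).

Definition isom_cast (a b : A) (e : a = b) : Isom a b :=
  match e with eq_refl => isom_id a end.

(** By proof irrelevance this depends on the end points only. All composites of such isomorphisms
    therefore agree. *)
Definition transport (a b : A) (e : repr a = repr b) : Isom a b :=
  isom_comp (isom_inv (to_repr b)) (isom_comp (isom_cast e) (to_repr a)).

Lemma transport_id (a : A) (e : repr a = repr a) : transport e = isom_id a.
Proof.
unfold transport. rewrite (proof_irrelevance _ e eq_refl). simpl.
rewrite isom_idl. apply isom_inv_l.
Qed.

Lemma transport_comp (a b c : A) (e : repr a = repr b) (e' : repr b = repr c)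
  (e'' : repr a = repr c) : isom_comp (transport e') (transport e) = transport e''.
Proof.
unfold transport. rewrite (proof_irrelevance _ e'' (eq_trans e e')).
rewrite <- !isom_assoc, (isom_assoc (to_repr b)), isom_inv_r, isom_idl.
f_equal. rewrite isom_assoc. f_equal. destruct e'. apply isom_idl.
Qed.

(* An invertible span from [a] to [c] amounts to an isomorphism from [a] to [c]
   and a germ at [a]. *)
Definition Germ (a : A) : Type := { e : A & Isom e a }.

Definition push (a b : A) (f : Isom a b) (p : Germ a) : Germ b :=
  existT _ (projT1 p) (isom_comp f (projT2 p)).

Lemma push_id (a : A) (p : Germ a) : push (isom_id a) p = p.
Proof. destruct p as [e f]. unfold push. simpl. now rewrite isom_idl. Qed.

Lemma push_comp (a b c : A) (g : Isom b c) (f : Isom a b) (p : Germ a) :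
  push g (push f p) = push (isom_comp g f) p.
Proof. unfold push. simpl. now rewrite isom_assoc. Qed.

Definition canonical_germ (a : A) : Germ a := existT _ (repr a) (isom_inv (to_repr a)).

(** The reason for moving germs along [transport]: an automorphism other than the identity would not
    fix the canonical germ. *)
Lemma push_canonical (a b : A) (e : repr a = repr b) :
  push (transport e) (canonical_germ a) = canonical_germ b.
Proof.
unfold push, canonical_germ, transport. simpl.
rewrite <- !isom_assoc, isom_inv_r, isom_idr.
generalize (isom_inv (to_repr b)). destruct e. intros f. simpl. now rewrite isom_idr.
Qed.

(* The left-zero semigroup on germs with a unit adjoined: any set with a chosen
   element carries such a monoid structure, and composing invertible spans
   through it makes composition strictly associative and unital. *)
Definition germ_mul (a : A) (p q : Germ a) : Germ a :=
  if excluded_middle_informative (p = canonical_germ a) then q else p.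

Lemma germ_mul_canonical_l (a : A) (p : Germ a) : germ_mul (canonical_germ a) p = p.
Proof.
unfold germ_mul. now destruct (excluded_middle_informative _).
Qed.

Lemma germ_mul_canonical_r (a : A) (p : Germ a) : germ_mul p (canonical_germ a) = p.
Proof.
unfold germ_mul. now destruct (excluded_middle_informative _).
Qed.

Lemma germ_mul_assoc (a : A) (p q r : Germ a) :
  germ_mul (germ_mul p q) r = germ_mul p (germ_mul q r).
Proof.
unfold germ_mul. destruct (excluded_middle_informative (p = _)); [reflexivity |].
now destruct (excluded_middle_informative (p = _)).
Qed.

(** Pushing along [transport] is a bijection that matches canonical germs, so both case distinctions
    take the same branch. *)
Lemma push_mul (a b : A) (e : repr a = repr b) (p q : Germ a) :
  push (transport e) (germ_mul p q)
  = germ_mul (push (transport e) p) (push (transport e) q).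
Proof.
unfold germ_mul.
destruct (excluded_middle_informative (p = _)) as [-> | n];
  destruct (excluded_middle_informative (push _ _ = _)) as [E | E]; try reflexivity.
- now rewrite push_canonical in E.
- destruct n. apply (f_equal (push (transport (eq_sym e)))) in E.
  rewrite push_canonical, push_comp, (transport_comp e (eq_sym e) eq_refl),
    transport_id, push_id in E.
  exact E.
Qed.

Definition span_of (a c : A) (p : Germ a) (f : Isom a c) : InvSpan a c :=
  {| sapex := projT1 p;
     sup := proj1_sig (projT2 p);
     sdown := proj1_sig f o proj1_sig (projT2 p);
     sup_iso := proj2_sig (projT2 p);
     sdown_iso := iso_comp (proj2_sig f) (proj2_sig (projT2 p)) |}.

Definition germ (a c : A) (u : InvSpan a c) : Germ a :=
  existT _ (sapex u) (exist _ (sup u) (sup_iso u)).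

Definition isom_of (a c : A) (u : InvSpan a c) : Isom a c :=
  isom_comp (exist _ (sdown u) (sdown_iso u))
    (isom_inv (exist _ (sup u) (sup_iso u))).

Lemma isom_of_sup (a c : A) (u : InvSpan a c) :
  proj1_sig (isom_of u) o sup u = sdown u.
Proof. simpl. rw (inv_l (sup_iso u)). reflexivity. Qed.

Lemma span_of_eta (a c : A) (u : InvSpan a c) : span_of (germ u) (isom_of u) = u.
Proof.
assert (E := isom_of_sup u).
destruct u as [e f g Hf Hg]. unfold span_of. simpl in *.
generalize (iso_comp (iso_comp Hg (iso_inv Hf)) Hf). rewrite E. intros Hg'.
f_equal. apply proof_irrelevance.
Qed.

Lemma invspan_ext (a c : A) (u v : InvSpan a c) :
  germ u = germ v -> isom_of u = isom_of v -> u = v.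
Proof.
intros E F. rewrite <- (span_of_eta u), <- (span_of_eta v). now rewrite E, F.
Qed.

Lemma germ_span_of (a c : A) (p : Germ a) (f : Isom a c) : germ (span_of p f) = p.
Proof. destruct p as [e [g Hg]]. reflexivity. Qed.

Lemma isom_of_span_of (a c : A) (p : Germ a) (f : Isom a c) :
  isom_of (span_of p f) = f.
Proof.
apply isom_ext. simpl. rw (inv_r (proj2_sig (projT2 p))). reflexivity.
Qed.

Definition span_id (a : A) : InvSpan a a := span_of (canonical_germ a) (isom_id a).

(** The resulting apex is that of [u], except that it is that of [v] when the germ of [u] is
    canonical. *)
Definition span_comp (a c e : A) (u : InvSpan a c) (v : InvSpan c e) : InvSpan a e :=
  span_of (germ_mul (germ u) (push (transport (repr_eq (isom_of u))) (germ v)))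
    (isom_comp (isom_of v) (isom_of u)).

Lemma germ_of_comp (a c e : A) (u : InvSpan a c) (v : InvSpan c e) :
  germ (span_comp u v)
  = germ_mul (germ u) (push (transport (repr_eq (isom_of u))) (germ v)).
Proof. apply germ_span_of. Qed.

Lemma isom_of_id (a : A) : isom_of (span_id a) = isom_id a.
Proof. apply isom_of_span_of. Qed.

Lemma isom_of_comp (a c e : A) (u : InvSpan a c) (v : InvSpan c e) :
  isom_of (span_comp u v) = isom_comp (isom_of v) (isom_of u).
Proof. apply isom_of_span_of. Qed.

Lemma span_comp_idl (a c : A) (u : InvSpan a c) : span_comp (span_id a) u = u.
Proof.
apply invspan_ext.
- rewrite germ_of_comp, transport_id, push_id.
  unfold span_id. rewrite germ_span_of. apply germ_mul_canonical_l.
- rewrite isom_of_comp, isom_of_id. apply isom_idr.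
Qed.

Lemma span_comp_idr (a c : A) (u : InvSpan a c) : span_comp u (span_id c) = u.
Proof.
apply invspan_ext.
- rewrite germ_of_comp. unfold span_id. rewrite germ_span_of, push_canonical.
  apply germ_mul_canonical_r.
- rewrite isom_of_comp, isom_of_id. apply isom_idl.
Qed.

Lemma span_comp_assoc (a b c d : A) (u : InvSpan a b) (v : InvSpan b c)
  (w : InvSpan c d) :
  span_comp (span_comp u v) w = span_comp u (span_comp v w).
Proof.
apply invspan_ext.
- rewrite !germ_of_comp, push_mul, germ_mul_assoc, push_comp. do 3 f_equal.
  symmetry. apply transport_comp.
- rewrite !isom_of_comp. apply isom_assoc.
Qed.

Definition span_proj1 (a c e : A) (u : InvSpan a c) (v : InvSpan c e) :
  Hom (sapex (span_comp u v)) (sapex u) := inv (sup_iso u) o sup (span_comp u v).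

Definition span_proj2 (a c e : A) (u : InvSpan a c) (v : InvSpan c e) :
  Hom (sapex (span_comp u v)) (sapex v) := inv (sdown_iso v) o sdown (span_comp u v).

(** The projections are forced by the outer legs. The square commutes because it does so after the
    isomorphism of [v], and it is a pullback because its first projection and [sup v] are
    invertible. *)
Lemma span_comp_composite (a c e : A) (u : InvSpan a c) (v : InvSpan c e) :
  SpanComposite (span_proj1 u v) (span_proj2 u v).
Proof.
assert (E1 : sup u o span_proj1 u v = sup (span_comp u v)).
{ unfold span_proj1. rw (inv_r (sup_iso u)). reflexivity. }
assert (E2 : sdown v o span_proj2 u v = sdown (span_comp u v)).
{ unfold span_proj2. rw (inv_r (sdown_iso v)). reflexivity. }
assert (E : sdown u o span_proj1 u v = sup v o span_proj2 u v).
{ apply (iso_mono (proj2_sig (isom_of v))).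
  rewrite (comp_assoc _ (sup v)), (isom_of_sup v), E2.
  rewrite <- (isom_of_sup (span_comp u v)), isom_of_comp, <- (isom_of_sup u), <- E1.
  cbn [isom_comp proj1_sig]. now assoc. }
assert (Hp : IsIso (span_proj1 u v)).
{ apply iso_comp; [apply iso_inv | apply sup_iso]. }
split; [| split; now symmetry].
apply pb_intro; [exact E | |].
- intros t h k F. exists (inv Hp o h). split.
  + rw (inv_r Hp). reflexivity.
  + apply (iso_mono (sup_iso v)). assoc. rewrite <- E. rw (inv_r Hp). exact F.
- intros t r r' F _. exact (iso_mono Hp F).
Qed.

End VerticalArrows.

(** * Presentations of fine rewrites *)

Section FineRewrites.
Variables (A X : Category) (L : Functor A X).

Lemma fmap_iso (a b : A) (f : Hom a b) : IsIso f -> IsIso (fmap L f).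
Proof.
intros [g [E1 E2]]. exists (fmap L g). rewrite <- !fmap_comp, E1, E2.
now rewrite !fmap_id.
Qed.

(** An outer column collapsed to a single isomorphism; presentations see the column only through
    it. *)
Definition side (a c : A) (u : InvSpan a c) : Hom (L a) (L c) :=
  fmap L (proj1_sig (isom_of u)).

Lemma side_iso (a c : A) (u : InvSpan a c) : IsIso (side u).
Proof. apply fmap_iso, (proj2_sig (isom_of u)). Qed.

Lemma side_id (a : A) : side (span_id a) = idm (L a).
Proof. unfold side. rewrite isom_of_id. apply fmap_id. Qed.

Lemma side_comp (a c e : A) (u : InvSpan a c) (v : InvSpan c e) :
  side (span_comp u v) = side v o side u.
Proof. unfold side. rewrite isom_of_comp. apply fmap_comp. Qed.

Lemma side_sup (a c : A) (u : InvSpan a c) :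
  side u o fmap L (sup u) = fmap L (sdown u).
Proof. unfold side. rewrite <- fmap_comp. f_equal. apply isom_of_sup. Qed.

Section OneSquare.
Variables (a a' c c' : A) (u : InvSpan a c) (v : InvSpan a' c').
Variables (M : StructuredCospan L a a') (N : StructuredCospan L c c').

(* As its central arrows are monic, a fine rewrite with given boundary is
   determined by the span formed by them. *)
Definition Presents (q : FineRewrite u v M N) (y : X)
  (m : Hom y (capex M)) (n : Hom y (capex N)) : Prop :=
  forall t, InClass t q <->
    exists theta : Hom y (capex (mid t)),
      IsIso theta /\ up t o theta = m /\ down t o theta = n.

Lemma class_ext (q q' : FineRewrite u v M N) :
  (forall t, InClass t q <-> InClass t q') -> q = q'.
Proof.
destruct q as [q Hq], q' as [q' Hq']. unfold InClass. simpl. intros H.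
assert (E : q = q').
{ apply functional_extensionality. intros t. now apply propositional_extensionality. }
subst q'. f_equal. apply proof_irrelevance.
Qed.

Lemma class_inhabited (q : FineRewrite u v M N) :
  exists t, InClass t q /\ Fine t.
Proof.
destruct q as [q [s [Hs H]]]. exists s. split; [| exact Hs].
unfold InClass. simpl. apply H.
exists (idm _). rewrite !comp_idl, !comp_idr. repeat split; auto using iso_id.
Qed.

(** The equations of [IsoSpan] about the legs of the middle row follow from those about central
    arrows: both sides agree after the monic [up t']. *)
Lemma presents_member (q : FineRewrite u v M N) t :
  InClass t q -> Presents q (up t) (down t).
Proof.
destruct q as [q [s [Hs H]]]. unfold Presents, InClass. simpl. intros Ht t'.
destruct Hs as [_ [Ms _]].
apply H in Ht. destruct Ht as [theta [It [T1 [T2 [T3 T4]]]]].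
rewrite H. split.
- intros [eta [Ie [E1 [E2 [E3 E4]]]]]. exists (eta o inv It). split; [| split].
  + apply iso_comp; [exact Ie | apply iso_inv].
  + apply (iso_epi It). rw (inv_l It). congruence.
  + apply (iso_epi It). rw (inv_l It). congruence.
- intros [eta [Ie [E1 E2]]].
  assert (F1 : up t' o (eta o theta) = up s) by (rw E1; exact T3).
  assert (F2 : down t' o (eta o theta) = down s) by (rw E2; exact T4).
  assert (Mt : Mono (up t')).
  { assert (I := iso_comp Ie It).
    replace (up t') with (up s o inv I).
    - apply mono_comp; [exact Ms | apply iso_mono, iso_inv].
    - rewrite <- F1, <- comp_assoc, (inv_r I). apply comp_idr. }
  exists (eta o theta). split; [now apply iso_comp | split; [| split; [| now split]]].
  + apply Mt. rewrite comp_assoc, F1. now rewrite !up_left.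
  + apply Mt. rewrite comp_assoc, F1. now rewrite !up_right.
Qed.

Lemma presents_exists (q : FineRewrite u v M N) :
  exists y (m : Hom y (capex M)) (n : Hom y (capex N)), Presents q m n.
Proof.
destruct (class_inhabited q) as [t [Ht _]].
exists (capex (mid t)), (up t), (down t). now apply presents_member.
Qed.

Lemma presents_eq (q q' : FineRewrite u v M N) y
  (m : Hom y (capex M)) (n : Hom y (capex N)) :
  Presents q m n -> Presents q' m n -> q = q'.
Proof. intros H H'. apply class_ext. intros t. now rewrite (H t), (H' t). Qed.

Lemma presents_iso (q : FineRewrite u v M N) y y'
  (m : Hom y (capex M)) (n : Hom y (capex N)) (theta : Hom y' y) :
  Presents q m n -> IsIso theta -> Presents q (m o theta) (n o theta).
Proof.
intros H It t. rewrite (H t). split.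
- intros [eta [Ie [E1 E2]]]. exists (eta o theta).
  split; [now apply iso_comp |]. split; [rw E1 | rw E2]; reflexivity.
- intros [eta [Ie [E1 E2]]]. exists (eta o inv It). split; [| split].
  + apply iso_comp; [exact Ie | apply iso_inv].
  + rw E1. rw (inv_r It). reflexivity.
  + rw E2. rw (inv_r It). reflexivity.
Qed.

Lemma presents_unique (q : FineRewrite u v M N) y y'
  (m : Hom y (capex M)) (n : Hom y (capex N))
  (m' : Hom y' (capex M)) (n' : Hom y' (capex N)) :
  Presents q m n -> Presents q m' n' ->
  exists theta : Hom y y', IsIso theta /\ m' o theta = m /\ n' o theta = n.
Proof.
intros H H'. destruct (class_inhabited q) as [t [Ht _]].
destruct (proj1 (H t) Ht) as [theta [It [T1 T2]]].
destruct (proj1 (H' t) Ht) as [eta [Ie [E1 E2]]].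
exists (inv Ie o theta). split; [| split].
- apply iso_comp; [apply iso_inv | exact It].
- rewrite <- E1. rw (inv_r Ie). exact T1.
- rewrite <- E2. rw (inv_r Ie). exact T2.
Qed.

Lemma presents_mono (q : FineRewrite u v M N) y
  (m : Hom y (capex M)) (n : Hom y (capex N)) :
  Presents q m n -> Mono m /\ Mono n.
Proof.
intros H. destruct (class_inhabited q) as [t [Ht [_ [Mu Md]]]].
destruct (proj1 (H t) Ht) as [theta [It [<- <-]]].
split; apply mono_comp; auto using iso_mono.
Qed.

(** The left leg is moved back along the invertible [fmap L (sup u)], so that the central row has
    the same foot [L a] as the top row. With [presents_right], this is what [presentation]
    inverts. *)
Lemma presents_left (q : FineRewrite u v M N) y
  (m : Hom y (capex M)) (n : Hom y (capex N)) :
  Presents q m n ->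
  exists l : Hom (L a) y, m o l = cleft M /\ n o l = cleft N o side u.
Proof.
intros H. destruct (class_inhabited q) as [t [Ht _]].
destruct (proj1 (H t) Ht) as [theta [It [<- <-]]].
assert (Iu := fmap_iso (sup_iso u)).
exists (inv It o cleft (mid t) o inv Iu). split; apply (iso_epi Iu).
- rw (inv_l Iu). rw (inv_r It). apply up_left.
- rw (inv_l Iu). rw (inv_r It). rw (side_sup u). apply down_left.
Qed.

Lemma presents_right (q : FineRewrite u v M N) y
  (m : Hom y (capex M)) (n : Hom y (capex N)) :
  Presents q m n ->
  exists r : Hom (L a') y, m o r = cright M /\ n o r = cright N o side v.
Proof.
intros H. destruct (class_inhabited q) as [t [Ht _]].
destruct (proj1 (H t) Ht) as [theta [It [<- <-]]].
assert (Iu := fmap_iso (sup_iso v)).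
exists (inv It o cright (mid t) o inv Iu). split; apply (iso_epi Iu).
- rw (inv_l Iu). rw (inv_r It). apply up_right.
- rw (inv_l Iu). rw (inv_r It). rw (side_sup v). apply down_right.
Qed.

Lemma presentation (y : X) (m : Hom y (capex M)) (n : Hom y (capex N))
  (l : Hom (L a) y) (r : Hom (L a') y) :
  Mono m -> Mono n -> m o l = cleft M -> n o l = cleft N o side u ->
  m o r = cright M -> n o r = cright N o side v ->
  exists q : FineRewrite u v M N, Presents q m n.
Proof.
intros Hm Hn Ml Nl Mr Nr.
unshelve epose (s := @Build_SpanOfCospans _ _ L a a' c c' u v M N
  {| capex := y; cleft := l o fmap L (sup u); cright := r o fmap L (sup v) |}
  m n _ _ _ _); simpl.
1: rw Ml; reflexivity.
1: rw Mr; reflexivity.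
1: rw Nl; rw (side_sup u); reflexivity.
1: rw Nr; rw (side_sup v); reflexivity.
assert (Fs : Fine s).
{ repeat split; try (apply fmap_iso; first [apply sup_iso | apply sdown_iso]);
    assumption. }
exists (exist _ (IsoSpan s) (ex_intro _ s (conj Fs (fun t => iff_refl _)))).
apply presents_member with (t := s).
exists (idm _). rewrite !comp_idl, !comp_idr. repeat split; auto using iso_id.
Qed.

End OneSquare.

(** * Vertical and horizontal composition of fine rewrites *)

Section Composites.
Variable T : IsTopos X.

(** One composite is claimed to serve all presentations and all pullbacks, so that each later law
    can pick convenient ones. It is built from one choice and transferred by [presents_unique]. *)
Lemma vertical_composite_exists (a a' c c' e e' : A) (u : InvSpan a c)
  (v : InvSpan a' c') (u' : InvSpan c e) (v' : InvSpan c' e')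
  (M : StructuredCospan L a a') (N : StructuredCospan L c c')
  (K : StructuredCospan L e e')
  (s : FineRewrite u v M N) (t : FineRewrite u' v' N K) :
  exists z : FineRewrite (span_comp u u') (span_comp v v') M K,
    forall y y' p (m : Hom y (capex M)) (n : Hom y (capex N))
      (m' : Hom y' (capex N)) (n' : Hom y' (capex K)) (p1 : Hom p y) (p2 : Hom p y'),
    Presents s m n -> Presents t m' n' -> IsPullback n m' p1 p2 ->
    Presents z (m o p1) (n' o p2).
Proof.
destruct (presents_exists s) as [x1 [m1 [n1 P1]]].
destruct (presents_exists t) as [x2 [m2 [n2 P2]]].
destruct (pullback_exists (topos_limits T) n1 m2) as [q [q1 [q2 Q]]].
destruct (presents_left P1) as [l1 [L1 L1']].
destruct (presents_left P2) as [l2 [L2 L2']].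
destruct (presents_right P1) as [r1 [R1 R1']].
destruct (presents_right P2) as [r2 [R2 R2']].
destruct (presents_mono P1) as [M1 N1]. destruct (presents_mono P2) as [M2 N2].
destruct (pb_lift Q (h := l1) (k := l2 o side u)) as [l [Q1 Q2]].
{ rw L2. exact L1'. }
destruct (pb_lift Q (h := r1) (k := r2 o side v)) as [r [Q1' Q2']].
{ rw R2. exact R1'. }
destruct (@presentation _ _ _ _ (span_comp u u') (span_comp v v') M K q
            (m1 o q1) (n2 o q2) l r) as [z Z].
- apply mono_comp; [exact M1 |]. exact (pb_mono_l Q M2).
- apply mono_comp; [exact N2 |]. exact (pb_mono_r Q N1).
- rw Q1. exact L1.
- rewrite side_comp. rw Q2. rw L2'. reflexivity.
- rw Q1'. exact R1.
- rewrite side_comp. rw Q2'. rw R2'. reflexivity.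
- exists z. intros y y' p m n m' n' p1 p2 S S' P.
  destruct (presents_unique S P1) as [al [Ia [A1 A2]]].
  destruct (presents_unique S' P2) as [be [Ib [B1 B2]]].
  assert (P' := pb_change P Ia Ib (iso_id p) A2 B1). rewrite !comp_idr in P'.
  destruct (pb_iso P' Q) as [th [It [T1 T2]]].
  assert (Z' := presents_iso Z It).
  rewrite <- !comp_assoc, T1, T2, !comp_assoc, A1, B2 in Z'. exact Z'.
Qed.

Definition vertical_composite (a a' c c' e e' : A) (u : InvSpan a c)
  (v : InvSpan a' c') (u' : InvSpan c e) (v' : InvSpan c' e')
  (M : StructuredCospan L a a') (N : StructuredCospan L c c')
  (K : StructuredCospan L e e')
  (s : FineRewrite u v M N) (t : FineRewrite u' v' N K) :
  FineRewrite (span_comp u u') (span_comp v v') M K :=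
  proj1_sig (choose _ (vertical_composite_exists s t)).

Lemma vertical_composite_presents (a a' c c' e e' : A) (u : InvSpan a c)
  (v : InvSpan a' c') (u' : InvSpan c e) (v' : InvSpan c' e')
  (M : StructuredCospan L a a') (N : StructuredCospan L c c')
  (K : StructuredCospan L e e')
  (s : FineRewrite u v M N) (t : FineRewrite u' v' N K)
  y y' p (m : Hom y (capex M)) (n : Hom y (capex N))
  (m' : Hom y' (capex N)) (n' : Hom y' (capex K)) (p1 : Hom p y) (p2 : Hom p y') :
  Presents s m n -> Presents t m' n' -> IsPullback n m' p1 p2 ->
  Presents (vertical_composite s t) (m o p1) (n' o p2).
Proof.
exact (proj2_sig (choose _ (vertical_composite_exists s t)) _ _ _ _ _ _ _ _ _).
Qed.

Definition cospan_comp (a b c : A) (M : StructuredCospan L a b)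
  (N : StructuredCospan L b c) : StructuredCospan L a c :=
  let (p, H) := choose _ (pushout_exists T (cright M) (cleft N)) in
  let (i1, H) := choose _ H in
  let (i2, H) := choose _ H in
  {| capex := p; cleft := i1 o cleft M; cright := i2 o cright N |}.

Lemma cospan_comp_exists (a b c : A) (M : StructuredCospan L a b)
  (N : StructuredCospan L b c) :
  exists (i1 : Hom (capex M) (capex (cospan_comp M N)))
    (i2 : Hom (capex N) (capex (cospan_comp M N))),
    CospanComposite (K := cospan_comp M N) i1 i2.
Proof.
unfold cospan_comp. destruct (choose _ _) as [p H1].
destruct (choose _ H1) as [i1 H2]. destruct (choose _ H2) as [i2 H3].
now exists i1, i2.
Qed.

Definition in1 (a b c : A) (M : StructuredCospan L a b)
  (N : StructuredCospan L b c) : Hom (capex M) (capex (cospan_comp M N)) :=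
  proj1_sig (choose _ (cospan_comp_exists M N)).

Definition in2 (a b c : A) (M : StructuredCospan L a b)
  (N : StructuredCospan L b c) : Hom (capex N) (capex (cospan_comp M N)) :=
  proj1_sig (choose _ (proj2_sig (choose _ (cospan_comp_exists M N)))).

Lemma cospan_comp_composite (a b c : A) (M : StructuredCospan L a b)
  (N : StructuredCospan L b c) : CospanComposite (in1 M N) (in2 M N).
Proof.
exact (proj2_sig (choose _ (proj2_sig (choose _ (cospan_comp_exists M N))))).
Qed.

Lemma cospan_comp_pushout (a b c : A) (M : StructuredCospan L a b)
  (N : StructuredCospan L b c) :
  IsPushout (cright M) (cleft N) (in1 M N) (in2 M N).
Proof. apply cospan_comp_composite. Qed.

Lemma cospan_comp_left (a b c : A) (M : StructuredCospan L a b)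
  (N : StructuredCospan L b c) : cleft (cospan_comp M N) = in1 M N o cleft M.
Proof. apply cospan_comp_composite. Qed.

Lemma cospan_comp_right (a b c : A) (M : StructuredCospan L a b)
  (N : StructuredCospan L b c) : cright (cospan_comp M N) = in2 M N o cright N.
Proof. apply cospan_comp_composite. Qed.

Lemma horizontal_composite_exists (a b c a' b' c' : A)
  (u : InvSpan a a') (v : InvSpan b b') (w : InvSpan c c')
  (M : StructuredCospan L a b) (N : StructuredCospan L b c)
  (M' : StructuredCospan L a' b') (N' : StructuredCospan L b' c')
  (s : FineRewrite u v M M') (t : FineRewrite v w N N') :
  exists z : FineRewrite u w (cospan_comp M N) (cospan_comp M' N'),
    forall y y' p (m : Hom y (capex M)) (n : Hom y (capex M'))
      (m' : Hom y' (capex N)) (n' : Hom y' (capex N'))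
      (r : Hom (L b) y) (l : Hom (L b) y') (k1 : Hom y p) (k2 : Hom y' p)
      (U : Hom p (capex (cospan_comp M N))) (D : Hom p (capex (cospan_comp M' N'))),
    Presents s m n -> Presents t m' n' ->
    m o r = cright M -> m' o l = cleft N -> IsPushout r l k1 k2 ->
    U o k1 = in1 M N o m -> U o k2 = in2 M N o m' ->
    D o k1 = in1 M' N' o n -> D o k2 = in2 M' N' o n' -> Presents z U D.
Proof.
destruct (presents_exists s) as [x1 [m1 [n1 P1]]].
destruct (presents_exists t) as [x2 [m2 [n2 P2]]].
destruct (presents_left P1) as [l1 [L1 L1']].
destruct (presents_left P2) as [l2 [L2 L2']].
destruct (presents_right P1) as [r1 [R1 R1']].
destruct (presents_right P2) as [r2 [R2 R2']].
destruct (presents_mono P1) as [M1 N1]. destruct (presents_mono P2) as [M2 N2].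
destruct (pushout_exists T r1 l2) as [z [z1 [z2 Z]]].
assert (O := cospan_comp_pushout M N). assert (O' := cospan_comp_pushout M' N').
destruct (po_desc Z (h := in1 M N o m1) (k := in2 M N o m2)) as [U0 [U1 U2]].
{ rw R1. rw L2. exact (po_comm O). }
destruct (po_desc Z (h := in1 M' N' o n1) (k := in2 M' N' o n2)) as [D0 [D1 D2]].
{ rw R1'. rw L2'. rw (po_comm O'). reflexivity. }
destruct (@presentation _ _ _ _ u w (cospan_comp M N) (cospan_comp M' N') z
            U0 D0 (z1 o l1) (z2 o r2)) as [q Q].
(* The central pushout is formed over [L b]. It lies over the top pushout by the identity of [L b]
   and over the bottom one by [side v], hence the two values of [sigma]. *)
- apply (po_mono T (f0 := r1) (g0 := l2) (sigma := idm (L b)) O Z M1 M2);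
    try assumption; [apply iso_id | now rewrite comp_idr | now rewrite comp_idr].
- now apply (po_mono T (f0 := r1) (g0 := l2) O' Z N1 N2 (side_iso v)).
- rewrite cospan_comp_left. rw U1. rw L1. reflexivity.
- rewrite cospan_comp_left. rw D1. rw L1'. reflexivity.
- rewrite cospan_comp_right. rw U2. rw R2. reflexivity.
- rewrite cospan_comp_right. rw D2. rw R2'. reflexivity.
- exists q. intros y y' p m n m' n' r l k1 k2 U D S S' R L' P E1 E2 F1 F2.
  destruct (presents_unique P1 S) as [al [Ia [A1 A2]]].
  destruct (presents_unique P2 S') as [be [Ib [B1 B2]]].
  destruct (presents_mono S) as [Mm _]. destruct (presents_mono S') as [Mm' _].
  assert (P' : IsPushout r1 l2 (k1 o al) (k2 o be)).
  { apply (po_change P Ia Ib).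
    - apply Mm. rw A1. congruence.
    - apply Mm'. rw B1. congruence. }
  destruct (po_iso P' Z) as [th [It [T1 T2]]].
  assert (Q' := presents_iso Q It).
  replace (U0 o th) with U in Q'.
  + replace (D0 o th) with D in Q'; [exact Q' |].
    apply (po_unique P').
    * rewrite <- (comp_assoc D0), T1, D1. rw F1. rw A2. reflexivity.
    * rewrite <- (comp_assoc D0), T2, D2. rw F2. rw B2. reflexivity.
  + apply (po_unique P').
    * rewrite <- (comp_assoc U0), T1, U1. rw E1. rw A1. reflexivity.
    * rewrite <- (comp_assoc U0), T2, U2. rw E2. rw B1. reflexivity.
Qed.

Definition horizontal_composite (a b c a' b' c' : A)
  (u : InvSpan a a') (v : InvSpan b b') (w : InvSpan c c')
  (M : StructuredCospan L a b) (N : StructuredCospan L b c)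
  (M' : StructuredCospan L a' b') (N' : StructuredCospan L b' c')
  (s : FineRewrite u v M M') (t : FineRewrite v w N N') :
  FineRewrite u w (cospan_comp M N) (cospan_comp M' N') :=
  proj1_sig (choose _ (horizontal_composite_exists s t)).

Lemma horizontal_composite_presents (a b c a' b' c' : A)
  (u : InvSpan a a') (v : InvSpan b b') (w : InvSpan c c')
  (M : StructuredCospan L a b) (N : StructuredCospan L b c)
  (M' : StructuredCospan L a' b') (N' : StructuredCospan L b' c')
  (s : FineRewrite u v M M') (t : FineRewrite v w N N')
  y y' p (m : Hom y (capex M)) (n : Hom y (capex M'))
  (m' : Hom y' (capex N)) (n' : Hom y' (capex N'))
  (r : Hom (L b) y) (l : Hom (L b) y') (k1 : Hom y p) (k2 : Hom y' p)
  (U : Hom p (capex (cospan_comp M N))) (D : Hom p (capex (cospan_comp M' N'))) :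
  Presents s m n -> Presents t m' n' ->
  m o r = cright M -> m' o l = cleft N -> IsPushout r l k1 k2 ->
  U o k1 = in1 M N o m -> U o k2 = in2 M N o m' ->
  D o k1 = in1 M' N' o n -> D o k2 = in2 M' N' o n' ->
  Presents (horizontal_composite s t) U D.
Proof.
exact (proj2_sig (choose _ (horizontal_composite_exists s t))
  _ _ _ _ _ _ _ _ _ _ _ _ _).
Qed.

(** Identities, associators and unitors all have this form, which turns equations between them into
    equations between arrows of [X]. *)
Lemma row_iso_exists (a b : A) (M N : StructuredCospan L a b)
  (phi : Hom (capex M) (capex N)) :
  IsIso phi -> phi o cleft M = cleft N -> phi o cright M = cright N ->
  exists q : FineRewrite (span_id a) (span_id b) M N, Presents q (idm _) phi.
Proof.
intros I E F. apply presentation with (l := cleft M) (r := cright M).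
- apply iso_mono, iso_id.
- now apply iso_mono.
- apply comp_idl.
- now rewrite side_id, comp_idr.
- apply comp_idl.
- now rewrite side_id, comp_idr.
Qed.

Section Units.
Variables (a b : A) (M : StructuredCospan L a b).

Lemma identity_exists :
  exists q : FineRewrite (span_id a) (span_id b) M M, Presents q (idm _) (idm _).
Proof. apply row_iso_exists; [apply iso_id | apply comp_idl | apply comp_idl]. Qed.

Definition identity_rewrite : FineRewrite (span_id a) (span_id b) M M :=
  proj1_sig (choose _ identity_exists).

Lemma identity_presents : Presents identity_rewrite (idm _) (idm _).
Proof. exact (proj2_sig (choose _ identity_exists)). Qed.

End Units.

Arguments identity_presents {a b} M.

(** A pullback along an identity is trivial, so a square presented by an identity and [phi] acts
    below by composition with [phi]; placed above, as in [vertical_presents_pre], it acts by the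
    inverse. *)
Lemma vertical_presents_post (a a' c c' e e' : A) (u : InvSpan a c)
  (v : InvSpan a' c') (u' : InvSpan c e) (v' : InvSpan c' e')
  (M : StructuredCospan L a a') (N : StructuredCospan L c c')
  (K : StructuredCospan L e e')
  (s : FineRewrite u v M N) (t : FineRewrite u' v' N K)
  y (m : Hom y (capex M)) (n : Hom y (capex N)) (phi : Hom (capex N) (capex K)) :
  Presents s m n -> Presents t (idm _) phi ->
  Presents (vertical_composite s t) m (phi o n).
Proof.
intros S Q. rewrite <- (comp_idr m).
exact (vertical_composite_presents S Q (pb_sym (pb_of_id_l n))).
Qed.

Lemma vertical_presents_pre (a a' c c' e e' : A) (u : InvSpan a c)
  (v : InvSpan a' c') (u' : InvSpan c e) (v' : InvSpan c' e')
  (M : StructuredCospan L a a') (N : StructuredCospan L c c')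
  (K : StructuredCospan L e e')
  (s : FineRewrite u v M N) (t : FineRewrite u' v' N K)
  y (m : Hom y (capex N)) (n : Hom y (capex K)) (m' : Hom y (capex M))
  (phi : Hom (capex M) (capex N)) :
  Presents s (idm _) phi -> IsIso phi -> Presents t m n -> phi o m' = m ->
  Presents (vertical_composite s t) m' n.
Proof.
intros S I Q E. rewrite <- (comp_idr n), <- (comp_idl m').
exact (vertical_composite_presents S Q (pb_of_iso_l I E)).
Qed.

Notation sqr q := (square (G := FineRewriteGraph L) q).

(** A presentation does not mention the sides, so squares with merely provably equal sides are
    compared without casts. *)
Lemma rewrite_square_ext (a b c d : A) (u u' : InvSpan a c) (v v' : InvSpan b d)
  (M : StructuredCospan L a b) (N : StructuredCospan L c d)
  (q : FineRewrite u v M N) (q' : FineRewrite u' v' M N)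
  y (m : Hom y (capex M)) (n : Hom y (capex N)) :
  u = u' -> v = v' -> Presents q m n -> Presents q' m n -> sqr q = sqr q'.
Proof. intros -> -> H H'. f_equal. exact (presents_eq H H'). Qed.

Lemma vertical_idl (a b c d : A) (u : InvSpan a c) (v : InvSpan b d)
  (M : StructuredCospan L a b) (N : StructuredCospan L c d)
  (s : FineRewrite u v M N) :
  sqr (vertical_composite (identity_rewrite M) s) = sqr s.
Proof.
destruct (presents_exists s) as [y [m [n P]]].
refine (rewrite_square_ext (span_comp_idl u) (span_comp_idl v) _ P).
exact (vertical_presents_pre (identity_presents M) (iso_id _) P (comp_idl m)).
Qed.

Lemma vertical_idr (a b c d : A) (u : InvSpan a c) (v : InvSpan b d)
  (M : StructuredCospan L a b) (N : StructuredCospan L c d)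
  (s : FineRewrite u v M N) :
  sqr (vertical_composite s (identity_rewrite N)) = sqr s.
Proof.
destruct (presents_exists s) as [y [m [n P]]].
refine (rewrite_square_ext (span_comp_idr u) (span_comp_idr v) _ P).
rewrite <- (comp_idl n).
exact (vertical_presents_post P (identity_presents N)).
Qed.

(** Both sides are presented on the limit [r] of the three central objects, obtained by pasting the
    pullbacks in either order. *)
Lemma vertical_assoc (a b c d e f g h : A) (u : InvSpan a c) (v : InvSpan b d)
  (u' : InvSpan c e) (v' : InvSpan d f) (u'' : InvSpan e g) (v'' : InvSpan f h)
  (M : StructuredCospan L a b) (N : StructuredCospan L c d)
  (K : StructuredCospan L e f) (P : StructuredCospan L g h)
  (s : FineRewrite u v M N) (s' : FineRewrite u' v' N K)
  (s'' : FineRewrite u'' v'' K P) :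
  sqr (vertical_composite (vertical_composite s s') s'')
  = sqr (vertical_composite s (vertical_composite s' s'')).
Proof.
destruct (presents_exists s) as [y1 [m1 [n1 P1]]].
destruct (presents_exists s') as [y2 [m2 [n2 P2]]].
destruct (presents_exists s'') as [y3 [m3 [n3 P3]]].
destruct (pullback_exists (topos_limits T) n1 m2) as [p [p1 [p2 B]]].
destruct (pullback_exists (topos_limits T) n2 m3) as [q [q1 [q2 B']]].
destruct (pullback_exists (topos_limits T) p2 q1) as [r [r1 [r2 B'']]].
assert (F := vertical_composite_presents (vertical_composite_presents P1 P2 B) P3
               (pb_paste B' B'')).
assert (F' := vertical_composite_presents P1 (vertical_composite_presents P2 P3 B')
               (pb_sym (pb_paste (pb_sym B) (pb_sym B'')))).
rewrite !comp_assoc in F, F'.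
exact (rewrite_square_ext (span_comp_assoc u u' u'') (span_comp_assoc v v' v'') F F').
Qed.

Definition rewriting_vertical : VerticalStructure (FineRewriteGraph L) :=
  {| vid := @span_id A : forall a : FineRewriteGraph L, ver a a;
     vcomp := @span_comp A : forall a c e : FineRewriteGraph L,
       ver a c -> ver c e -> ver a e;
     vcomp_idl := @span_comp_idl A;
     vcomp_idr := @span_comp_idr A;
     vcomp_assoc := @span_comp_assoc A;
     sid := identity_rewrite;
     scomp := @vertical_composite;
     scomp_idl := @vertical_idl;
     scomp_idr := @vertical_idr;
     scomp_assoc := @vertical_assoc |}.

(** * Horizontal units *)

Definition unit_cospan (a : A) : StructuredCospan L a a :=
  {| capex := L a; cleft := idm (L a); cright := idm (L a) |}.

Lemma unit_rewrite_exists (a c : A) (u : InvSpan a c) :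
  exists q : FineRewrite u u (unit_cospan a) (unit_cospan c),
    Presents q (idm (L a)) (side u).
Proof.
apply presentation with (l := idm (L a)) (r := idm (L a)); simpl;
  rewrite ?comp_idl, ?comp_idr; try reflexivity; apply iso_mono.
- apply iso_id.
- apply side_iso.
Qed.

Definition unit_rewrite (a c : A) (u : InvSpan a c) :
  FineRewrite u u (unit_cospan a) (unit_cospan c) :=
  proj1_sig (choose _ (unit_rewrite_exists u)).

Lemma unit_rewrite_presents (a c : A) (u : InvSpan a c) :
  Presents (unit_rewrite u) (idm (L a)) (side u).
Proof. exact (proj2_sig (choose _ (unit_rewrite_exists u))). Qed.

Arguments unit_rewrite_presents {a c} u.

Lemma unit_rewrite_id (a : A) :
  unit_rewrite (span_id a) = identity_rewrite (unit_cospan a).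
Proof.
assert (P := unit_rewrite_presents (span_id a)). rewrite side_id in P.
exact (presents_eq P (identity_presents (unit_cospan a))).
Qed.

Lemma unit_rewrite_comp (a c e : A) (u : InvSpan a c) (u' : InvSpan c e) :
  unit_rewrite (span_comp u u') = vertical_composite (unit_rewrite u) (unit_rewrite u').
Proof.
assert (P := unit_rewrite_presents (span_comp u u')). rewrite side_comp in P.
refine (presents_eq P _).
exact (vertical_presents_post (unit_rewrite_presents u) (unit_rewrite_presents u')).
Qed.

(** * Functoriality of horizontal composition *)

Lemma horizontal_id (a b c : A) (M : StructuredCospan L a b)
  (N : StructuredCospan L b c) :
  horizontal_composite (identity_rewrite M) (identity_rewrite N)
  = identity_rewrite (cospan_comp M N).
Proof.
refine (presents_eq _ (identity_presents _)).
refine (horizontal_composite_presents (identity_presents M) (identity_presents N)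
  (comp_idl _) (comp_idl _) (cospan_comp_pushout M N) _ _ _ _); now assoc.
Qed.

Lemma horizontal_row_iso (a b c : A) (M M' : StructuredCospan L a b)
  (N N' : StructuredCospan L b c)
  (q : FineRewrite (span_id a) (span_id b) M M')
  (q' : FineRewrite (span_id b) (span_id c) N N')
  (phi : Hom (capex M) (capex M')) (psi : Hom (capex N) (capex N')) :
  Presents q (idm _) phi -> Presents q' (idm _) psi ->
  exists chi : Hom (capex (cospan_comp M N)) (capex (cospan_comp M' N')),
    Presents (horizontal_composite q q') (idm _) chi
    /\ chi o in1 M N = in1 M' N' o phi /\ chi o in2 M N = in2 M' N' o psi.
Proof.
intros Q Q'.
destruct (presents_right Q) as [r [R1 R2]]. destruct (presents_left Q') as [l [L1 L2]].
rewrite comp_idl in R1, L1. subst r l. rewrite side_id, comp_idr in R2, L2.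
destruct (po_desc (cospan_comp_pushout M N) (h := in1 M' N' o phi)
            (k := in2 M' N' o psi)) as [chi [C1 C2]].
{ rw R2. rw L2. exact (po_comm (cospan_comp_pushout M' N')). }
exists chi. split; [| now split].
refine (horizontal_composite_presents Q Q' (comp_idl _) (comp_idl _)
  (cospan_comp_pushout M N) _ _ C1 C2); now assoc.
Qed.

(* The pullback over the middle row of the two composite central objects is, by
   stability of pushouts under pullback along monomorphisms, the pushout of the
   two pullbacks of central objects. *)
Lemma interchange (a b c a' b' c' a'' b'' c'' : A)
  (u : InvSpan a a') (v : InvSpan b b') (w : InvSpan c c')
  (u' : InvSpan a' a'') (v' : InvSpan b' b'') (w' : InvSpan c' c'')
  (M : StructuredCospan L a b) (N : StructuredCospan L b c)
  (M' : StructuredCospan L a' b') (N' : StructuredCospan L b' c')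
  (M'' : StructuredCospan L a'' b'') (N'' : StructuredCospan L b'' c'')
  (s : FineRewrite u v M M') (t : FineRewrite v w N N')
  (s' : FineRewrite u' v' M' M'') (t' : FineRewrite v' w' N' N'') :
  horizontal_composite (vertical_composite s s') (vertical_composite t t')
  = vertical_composite (horizontal_composite s t) (horizontal_composite s' t').
Proof.
destruct (presents_exists s) as [y1 [m1 [n1 P1]]].
destruct (presents_exists t) as [y2 [m2 [n2 P2]]].
destruct (presents_exists s') as [y1' [m1' [n1' P1']]].
destruct (presents_exists t') as [y2' [m2' [n2' P2']]].
destruct (presents_right P1) as [r [R1 R2]].
destruct (presents_left P2) as [l [L1 L2]].
destruct (presents_right P1') as [r' [R1' R2']].
destruct (presents_left P2') as [l' [L1' L2']].
destruct (presents_mono P1) as [M1 N1]. destruct (presents_mono P2) as [M2 N2].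
destruct (presents_mono P1') as [M1' N1'].
destruct (presents_mono P2') as [M2' N2'].
assert (O := cospan_comp_pushout M N). assert (O' := cospan_comp_pushout M' N').
assert (O'' := cospan_comp_pushout M'' N'').
destruct (pushout_exists T r l) as [z [z1 [z2 Z]]].
destruct (pushout_exists T r' l') as [z' [z1' [z2' Z']]].
destruct (po_desc Z (h := in1 M N o m1) (k := in2 M N o m2)) as [U [U1 U2]].
{ rw R1. rw L1. exact (po_comm O). }
destruct (po_desc Z (h := in1 M' N' o n1) (k := in2 M' N' o n2)) as [D [D1 D2]].
{ rw R2. rw L2. rw (po_comm O'). reflexivity. }
destruct (po_desc Z' (h := in1 M' N' o m1') (k := in2 M' N' o m2')) as [U' [U1' U2']].
{ rw R1'. rw L1'. exact (po_comm O'). }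
destruct (po_desc Z' (h := in1 M'' N'' o n1') (k := in2 M'' N'' o n2'))
  as [D' [D1' D2']].
{ rw R2'. rw L2'. rw (po_comm O''). reflexivity. }
assert (H := horizontal_composite_presents P1 P2 R1 L1 Z U1 U2 D1 D2).
assert (H' := horizontal_composite_presents P1' P2' R1' L1' Z' U1' U2' D1' D2').
destruct (po_mono T (f0 := r) (g0 := l) O' Z N1 N2 (side_iso v) R2 L2 D1 D2)
  as [MD [B1 B2]].
assert (R3 : m1' o r' = cright M' o idm (L b')) by now rewrite comp_idr.
assert (L3 : m2' o l' = cleft N' o idm (L b')) by now rewrite comp_idr.
destruct (po_mono T O' Z' M1' M2' (iso_id _) R3 L3 U1' U2') as [MU [B1' B2']].
destruct (pullback_exists (topos_limits T) D U') as [x [x1 [x2 Q]]].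
destruct (pullback_exists (topos_limits T) n1 m1') as [w1 [a1 [b1 W1]]].
destruct (pullback_exists (topos_limits T) n2 m2') as [w2 [a2 [b2 W2]]].
destruct (pb_lift W1 (h := r) (k := r' o side v)) as [rr [RR1 RR2]].
{ rw R1'. exact R2. }
destruct (pb_lift W2 (h := l) (k := l' o side v)) as [ll [LL1 LL2]].
{ rw L1'. exact L2. }
destruct (pb_lift Q (h := z1 o a1) (k := z1' o b1)) as [k1 [K1 K1']].
{ rw D1. rw U1'. rw (pb_comm W1). reflexivity. }
destruct (pb_lift Q (h := z2 o a2) (k := z2' o b2)) as [k2 [K2 K2']].
{ rw D2. rw U2'. rw (pb_comm W2). reflexivity. }
assert (S : IsPushout rr ll k1 k2).
(* The middle row is glued along [L b'], whereas the intersections have legs from [L b]; [side v]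
   compares the two. *)
{ apply (po_restrict T (n := D o x1) (m := n1 o a1) (m' := n2 o a2)
           (sigma := side v) O').
  - apply mono_comp; [exact MD |]. exact (pb_mono_l Q MU).
  - exact (pb_intersect B1 B1' Q W1 K1 K1').
  - exact (pb_intersect B2 B2' Q W2 K2 K2').
  - apply side_iso.
  - rw RR1. exact R2.
  - rw LL1. exact L2. }
assert (V1 := vertical_composite_presents P1 P1' W1).
assert (V2 := vertical_composite_presents P2 P2' W2).
refine (presents_eq _ (vertical_composite_presents H H' Q)).
refine (horizontal_composite_presents V1 V2 _ _ S _ _ _ _).
- rw RR1. exact R1.
- rw LL1. exact L1.
- rw K1. rw U1. reflexivity.
- rw K2. rw U2. reflexivity.
- rw K1'. rw D1'. reflexivity.
- rw K2'. rw D2'. reflexivity.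
Qed.

(** * Associativity and unit isomorphisms *)

Lemma row_iso_invertible (a b : A) (M N : StructuredCospan L a b)
  (q : FineRewrite (span_id a) (span_id b) M N) (phi : Hom (capex M) (capex N)) :
  Presents q (idm _) phi -> IsIso phi ->
  IsIso (cell (G := FineRewriteGraph L) rewriting_vertical q).
Proof.
intros Q I.
destruct (presents_left Q) as [l [L1 L2]]. destruct (presents_right Q) as [r [R1 R2]].
rewrite comp_idl in L1, R1. subst l r. rewrite side_id, comp_idr in L2, R2.
destruct (@row_iso_exists _ _ N M (inv I)) as [q' Q'].
- apply iso_inv.
- rewrite <- L2. rw (inv_l I). reflexivity.
- rewrite <- R2. rw (inv_l I). reflexivity.
- exists (cell (G := FineRewriteGraph L) rewriting_vertical q'). split.
  + assert (E := vertical_presents_post Q Q'). rewrite (inv_l I) in E.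
    exact (rewrite_square_ext (span_comp_idl _) (span_comp_idl _) E
             (identity_presents M)).
  (* Here the composite is presented by [phi] twice, which the inverse of [phi] reparametrizes to
     two identities. *)
  + assert (E := vertical_presents_pre Q' (iso_inv I) Q (inv_l I)).
    assert (E' := presents_iso E (iso_inv I)).
    rewrite (inv_r I) in E'.
    exact (rewrite_square_ext (span_comp_idl _) (span_comp_idl _) E'
             (identity_presents N)).
Qed.

(** The equations on the three injections are kept because they determine [alpha]; naturality and
    coherence are verified on them. *)
Lemma associator_exists (a b c d : A) (M : StructuredCospan L a b)
  (N : StructuredCospan L b c) (P : StructuredCospan L c d) :
  exists q : FineRewrite (span_id a) (span_id d)
               (cospan_comp (cospan_comp M N) P) (cospan_comp M (cospan_comp N P)),
  exists alpha, IsIso alpha /\ Presents q (idm _) alpha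
    /\ alpha o in1 (cospan_comp M N) P o in1 M N = in1 M (cospan_comp N P)
    /\ alpha o in1 (cospan_comp M N) P o in2 M N
       = in2 M (cospan_comp N P) o in1 N P
    /\ alpha o in2 (cospan_comp M N) P = in2 M (cospan_comp N P) o in2 N P.
Proof.
assert (MN := cospan_comp_pushout M N). assert (NP := cospan_comp_pushout N P).
assert (MNP := cospan_comp_pushout (cospan_comp M N) P).
assert (MNP' := cospan_comp_pushout M (cospan_comp N P)).
rewrite cospan_comp_right in MNP. rewrite cospan_comp_left in MNP'.
destruct (po_desc NP (h := in1 (cospan_comp M N) P o in2 M N)
            (k := in2 (cospan_comp M N) P)) as [w [W1 W2]].
{ rewrite <- comp_assoc. exact (po_comm MNP). }
destruct (po_iso (po_assoc MN NP MNP W1 W2) MNP') as [alpha [I [E1 E2]]].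
rewrite comp_assoc in E1.
assert (E3 : alpha o in1 (cospan_comp M N) P o in2 M N
             = in2 M (cospan_comp N P) o in1 N P).
{ rewrite <- comp_assoc, <- W1, comp_assoc. now rewrite E2. }
assert (E4 : alpha o in2 (cospan_comp M N) P = in2 M (cospan_comp N P) o in2 N P).
{ rewrite <- W2, comp_assoc. now rewrite E2. }
destruct (row_iso_exists I) as [q Q].
- rewrite !cospan_comp_left. rw E1. reflexivity.
- rewrite !cospan_comp_right. rw E4. reflexivity.
- exists q, alpha. auto 6.
Qed.

Definition associator (a b c d : A) (M : StructuredCospan L a b)
  (N : StructuredCospan L b c) (P : StructuredCospan L c d) :
  FineRewrite (span_id a) (span_id d)
    (cospan_comp (cospan_comp M N) P) (cospan_comp M (cospan_comp N P)) :=
  proj1_sig (choose _ (associator_exists M N P)).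

Lemma associator_spec (a b c d : A) (M : StructuredCospan L a b)
  (N : StructuredCospan L b c) (P : StructuredCospan L c d) :
  exists alpha, IsIso alpha /\ Presents (associator M N P) (idm _) alpha
    /\ alpha o in1 (cospan_comp M N) P o in1 M N = in1 M (cospan_comp N P)
    /\ alpha o in1 (cospan_comp M N) P o in2 M N
       = in2 M (cospan_comp N P) o in1 N P
    /\ alpha o in2 (cospan_comp M N) P = in2 M (cospan_comp N P) o in2 N P.
Proof. exact (proj2_sig (choose _ (associator_exists M N P))). Qed.

Lemma left_unitor_exists (a b : A) (M : StructuredCospan L a b) :
  exists q : FineRewrite (span_id a) (span_id b) (cospan_comp (unit_cospan a) M) M,
  exists lambda, IsIso lambda /\ Presents q (idm _) lambda
    /\ lambda o in1 (unit_cospan a) M = cleft M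
    /\ lambda o in2 (unit_cospan a) M = idm _.
Proof.
destruct (po_iso (cospan_comp_pushout (unit_cospan a) M) (po_of_id_l (cleft M)))
  as [lambda [I [E1 E2]]].
destruct (@row_iso_exists _ _ (cospan_comp (unit_cospan a) M) M lambda I) as [q Q].
- rewrite cospan_comp_left. rw E1. reflexivity.
- rewrite cospan_comp_right. rw E2. reflexivity.
- exists q, lambda. auto.
Qed.

Definition left_unitor (a b : A) (M : StructuredCospan L a b) :
  FineRewrite (span_id a) (span_id b) (cospan_comp (unit_cospan a) M) M :=
  proj1_sig (choose _ (left_unitor_exists M)).

Lemma left_unitor_spec (a b : A) (M : StructuredCospan L a b) :
  exists lambda, IsIso lambda /\ Presents (left_unitor M) (idm _) lambda
    /\ lambda o in1 (unit_cospan a) M = cleft M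
    /\ lambda o in2 (unit_cospan a) M = idm _.
Proof. exact (proj2_sig (choose _ (left_unitor_exists M))). Qed.

Lemma right_unitor_exists (a b : A) (M : StructuredCospan L a b) :
  exists q : FineRewrite (span_id a) (span_id b) (cospan_comp M (unit_cospan b)) M,
  exists rho, IsIso rho /\ Presents q (idm _) rho
    /\ rho o in1 M (unit_cospan b) = idm _
    /\ rho o in2 M (unit_cospan b) = cright M.
Proof.
destruct (po_iso (cospan_comp_pushout M (unit_cospan b)) (po_of_id_r (cright M)))
  as [rho [I [E1 E2]]].
destruct (@row_iso_exists _ _ (cospan_comp M (unit_cospan b)) M rho I) as [q Q].
- rewrite cospan_comp_left. rw E1. reflexivity.
- rewrite cospan_comp_right. rw E2. reflexivity.
- exists q, rho. auto.
Qed.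

Definition right_unitor (a b : A) (M : StructuredCospan L a b) :
  FineRewrite (span_id a) (span_id b) (cospan_comp M (unit_cospan b)) M :=
  proj1_sig (choose _ (right_unitor_exists M)).

Lemma right_unitor_spec (a b : A) (M : StructuredCospan L a b) :
  exists rho, IsIso rho /\ Presents (right_unitor M) (idm _) rho
    /\ rho o in1 M (unit_cospan b) = idm _
    /\ rho o in2 M (unit_cospan b) = cright M.
Proof. exact (proj2_sig (choose _ (right_unitor_exists M))). Qed.

Lemma associator_iso (a b c d : A) (M : StructuredCospan L a b)
  (N : StructuredCospan L b c) (P : StructuredCospan L c d) :
  IsIso (cell (G := FineRewriteGraph L) rewriting_vertical (associator M N P)).
Proof.
destruct (associator_spec M N P) as [alpha [I [Q _]]].
exact (row_iso_invertible Q I).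
Qed.

Lemma left_unitor_iso (a b : A) (M : StructuredCospan L a b) :
  IsIso (cell (G := FineRewriteGraph L) rewriting_vertical (left_unitor M)).
Proof.
destruct (left_unitor_spec M) as [lambda [I [Q _]]].
exact (row_iso_invertible Q I).
Qed.

Lemma right_unitor_iso (a b : A) (M : StructuredCospan L a b) :
  IsIso (cell (G := FineRewriteGraph L) rewriting_vertical (right_unitor M)).
Proof.
destruct (right_unitor_spec M) as [rho [I [Q _]]].
exact (row_iso_invertible Q I).
Qed.

(** The two composites in a naturality square have these sides. *)
Lemma span_comp_unitary (a c : A) (u : InvSpan a c) :
  span_comp u (span_id c) = span_comp (span_id a) u.
Proof. now rewrite span_comp_idl, span_comp_idr. Qed.

(** Both horizontal composites are presented on the same triple pushout [z], described a second time
    by [po_assoc]; [alpha] and [alpha'] enter only through the arrows from [z] to the rows. *)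
Lemma associator_natural (a b c d a' b' c' d' : A)
  (u : InvSpan a a') (v : InvSpan b b') (w : InvSpan c c') (x : InvSpan d d')
  (M : StructuredCospan L a b) (N : StructuredCospan L b c)
  (P : StructuredCospan L c d) (M' : StructuredCospan L a' b')
  (N' : StructuredCospan L b' c') (P' : StructuredCospan L c' d')
  (r : FineRewrite u v M M') (s : FineRewrite v w N N') (t : FineRewrite w x P P') :
  sqr (vertical_composite (horizontal_composite (horizontal_composite r s) t)
         (associator M' N' P'))
  = sqr (vertical_composite (associator M N P)
           (horizontal_composite r (horizontal_composite s t))).
Proof.
destruct (presents_exists r) as [y1 [m1 [n1 Q1]]].
destruct (presents_exists s) as [y2 [m2 [n2 Q2]]].
destruct (presents_exists t) as [y3 [m3 [n3 Q3]]].
destruct (presents_right Q1) as [r1 [R1 R1']].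
destruct (presents_left Q2) as [l2 [L2 L2']].
destruct (presents_right Q2) as [r2 [R2 R2']].
destruct (presents_left Q3) as [l3 [L3 L3']].
assert (MN := cospan_comp_pushout M N). assert (NP := cospan_comp_pushout N P).
assert (MN' := cospan_comp_pushout M' N'). assert (NP' := cospan_comp_pushout N' P').
assert (O := cospan_comp_pushout (cospan_comp M N) P).
assert (O' := cospan_comp_pushout (cospan_comp M' N') P').
rewrite cospan_comp_right in O, O'.
destruct (pushout_exists T r1 l2) as [z12 [k1 [k2 Z12]]].
destruct (pushout_exists T r2 l3) as [z23 [j2 [j3 Z23]]].
destruct (pushout_exists T (k2 o r2) l3) as [z [e1 [e2 Z]]].
destruct (po_desc Z12 (h := in1 M N o m1) (k := in2 M N o m2)) as [U [U1 U2]].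
{ rw R1. rw L2. exact (po_comm MN). }
destruct (po_desc Z12 (h := in1 M' N' o n1) (k := in2 M' N' o n2)) as [D [D1 D2]].
{ rw R1'. rw L2'. rw (po_comm MN'). reflexivity. }
destruct (po_desc Z23 (h := in1 N P o m2) (k := in2 N P o m3)) as [V [V1 V2]].
{ rw R2. rw L3. exact (po_comm NP). }
destruct (po_desc Z23 (h := in1 N' P' o n2) (k := in2 N' P' o n3)) as [E [E1 E2]].
{ rw R2'. rw L3'. rw (po_comm NP'). reflexivity. }
destruct (po_desc Z (h := in1 (cospan_comp M N) P o U)
            (k := in2 (cospan_comp M N) P o m3)) as [UU [UU1 UU2]].
{ rw U2. rw R2. rw L3. rw (po_comm O). reflexivity. }
destruct (po_desc Z (h := in1 (cospan_comp M' N') P' o D)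
            (k := in2 (cospan_comp M' N') P' o n3)) as [DD [DD1 DD2]].
{ rw D2. rw R2'. rw L3'. rw (po_comm O'). reflexivity. }
destruct (po_desc Z23 (h := e1 o k2) (k := e2)) as [f [F1 F2]].
{ rewrite <- comp_assoc. exact (po_comm Z). }
assert (ZZ := po_assoc Z12 Z23 Z F1 F2).
assert (H12 := horizontal_composite_presents Q1 Q2 R1 L2 Z12 U1 U2 D1 D2).
assert (H23 := horizontal_composite_presents Q2 Q3 R2 L3 Z23 V1 V2 E1 E2).
assert (H : Presents (horizontal_composite (horizontal_composite r s) t) UU DD).
{ refine (horizontal_composite_presents H12 Q3 _ L3 Z UU1 UU2 DD1 DD2).
  rewrite cospan_comp_right. rw U2. rw R2. reflexivity. }
destruct (associator_spec M N P) as [alpha [I [W [A1 [A2 A3]]]]].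
destruct (associator_spec M' N' P') as [alpha' [I' [W' [A1' [A2' A3']]]]].
assert (H' : Presents (horizontal_composite r (horizontal_composite s t))
               (alpha o UU) (alpha' o DD)).
{ refine (horizontal_composite_presents Q1 H23 R1 _ ZZ _ _ _ _).
  - rewrite cospan_comp_left. rw V1. rw L2. reflexivity.
  - rw UU1. rw U1. rw A1. reflexivity.
  - apply (po_unique Z23).
    + rw F1. rw UU1. rw U2. rw A2. rw V1. reflexivity.
    + rw F2. rw UU2. rw A3. rw V2. reflexivity.
  - rw DD1. rw D1. rw A1'. reflexivity.
  - apply (po_unique Z23).
    + rw F1. rw DD1. rw D2. rw A2'. rw E1. reflexivity.
    + rw F2. rw DD2. rw A3'. rw E2. reflexivity. }
exact (rewrite_square_ext (span_comp_unitary u) (span_comp_unitary x)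
         (vertical_presents_post H W') (vertical_presents_pre W I H' eq_refl)).
Qed.

(** Gluing a unit square along an identity leaves the central object [y] of [s] unchanged, so both
    composites are presented on [y]. *)
Lemma left_unitor_natural (a b a' b' : A) (u : InvSpan a a') (v : InvSpan b b')
  (M : StructuredCospan L a b) (M' : StructuredCospan L a' b')
  (s : FineRewrite u v M M') :
  sqr (vertical_composite (horizontal_composite (unit_rewrite u) s) (left_unitor M'))
  = sqr (vertical_composite (left_unitor M) s).
Proof.
destruct (presents_exists s) as [y [m [n Q]]].
destruct (presents_left Q) as [l [L1 L2]].
destruct (left_unitor_spec M) as [lambda [I [W [_ E]]]].
destruct (left_unitor_spec M') as [lambda' [I' [W' [_ E']]]].
assert (O := po_comm (cospan_comp_pushout (unit_cospan a) M)).
assert (O' := po_comm (cospan_comp_pushout (unit_cospan a') M')).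
simpl in O, O'. rewrite comp_idr in O, O'.
assert (H : Presents (horizontal_composite (unit_rewrite u) s)
              (in2 (unit_cospan a) M o m) (in2 (unit_cospan a') M' o n)).
{ refine (horizontal_composite_presents (unit_rewrite_presents u) Q
            (comp_idl _) L1 (po_of_id_l l) _ _ _ _).
  - rw L1. now rewrite O.
  - now assoc.
  - rw L2. now rewrite <- O'.
  - now assoc. }
assert (F := vertical_presents_post H W').
rewrite comp_assoc, E', comp_idl in F.
refine (rewrite_square_ext (span_comp_unitary u) (span_comp_unitary v) F _).
apply (vertical_presents_pre W I Q). rw E. reflexivity.
Qed.

Lemma right_unitor_natural (a b a' b' : A) (u : InvSpan a a') (v : InvSpan b b')
  (M : StructuredCospan L a b) (M' : StructuredCospan L a' b')
  (s : FineRewrite u v M M') :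
  sqr (vertical_composite (horizontal_composite s (unit_rewrite v)) (right_unitor M'))
  = sqr (vertical_composite (right_unitor M) s).
Proof.
destruct (presents_exists s) as [y [m [n Q]]].
destruct (presents_right Q) as [r [R1 R2]].
destruct (right_unitor_spec M) as [rho [I [W [E _]]]].
destruct (right_unitor_spec M') as [rho' [I' [W' [E' _]]]].
assert (O := po_comm (cospan_comp_pushout M (unit_cospan b))).
assert (O' := po_comm (cospan_comp_pushout M' (unit_cospan b'))).
simpl in O, O'. rewrite comp_idr in O, O'.
assert (H : Presents (horizontal_composite s (unit_rewrite v))
              (in1 M (unit_cospan b) o m) (in1 M' (unit_cospan b') o n)).
{ refine (horizontal_composite_presents Q (unit_rewrite_presents v) R1
            (comp_idl _) (po_of_id_r r) _ _ _ _).
  - now assoc.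
  - rw R1. now rewrite <- O.
  - now assoc.
  - rw R2. now rewrite O'. }
assert (F := vertical_presents_post H W').
rewrite comp_assoc, E', comp_idl in F.
refine (rewrite_square_ext (span_comp_unitary u) (span_comp_unitary v) F _).
apply (vertical_presents_pre W I Q). rw E. reflexivity.
Qed.

(** Both sides have an identity as upper central arrow; their lower ones start from an iterated
    pushout and are compared on its four injections. *)
Lemma associator_pentagon (a b c d e : A) (M : StructuredCospan L a b)
  (N : StructuredCospan L b c) (P : StructuredCospan L c d)
  (Q : StructuredCospan L d e) :
  sqr (vertical_composite
         (horizontal_composite (associator M N P) (identity_rewrite Q))
         (vertical_composite (associator M (cospan_comp N P) Q)
            (horizontal_composite (identity_rewrite M) (associator N P Q))))
  = sqr (vertical_composite (associator (cospan_comp M N) P Q)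
           (associator M N (cospan_comp P Q))).
Proof.
destruct (associator_spec M N P) as [a1 [_ [A1 [E1 [E2 E3]]]]].
destruct (associator_spec M (cospan_comp N P) Q) as [a2 [_ [A2 [F1 [F2 F3]]]]].
destruct (associator_spec N P Q) as [a3 [_ [A3 [G1 [G2 G3]]]]].
destruct (associator_spec (cospan_comp M N) P Q) as [a4 [_ [A4 [H1 [H2 H3]]]]].
destruct (associator_spec M N (cospan_comp P Q)) as [a5 [_ [A5 [K1 [K2 K3]]]]].
destruct (horizontal_row_iso A1 (identity_presents Q)) as [c1 [C1 [C2 C3]]].
destruct (horizontal_row_iso (identity_presents M) A3) as [c3 [D1 [D2 D3]]].
rewrite comp_idr in C3, D2.
assert (V := vertical_presents_post C1 (vertical_presents_post A2 D1)).
assert (V' := vertical_presents_post A4 A5).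
assert (W : c3 o a2 o c1 = a5 o a4).
{ apply (po_unique (cospan_comp_pushout (cospan_comp (cospan_comp M N) P) Q)).
  - apply (po_unique (cospan_comp_pushout (cospan_comp M N) P)).
    + apply (po_unique (cospan_comp_pushout M N)).
      * rw C2. rw E1. rw F1. rw D2. rw H1. rw K1. reflexivity.
      * rw C2. rw E2. rw F2. rw D3. rw G1. rw H1. rw K2. reflexivity.
    + rw C2. rw E3. rw F2. rw D3. rw G2. rw H2. rw K3. reflexivity.
  - rw C3. rw F3. rw D3. rw G3. rw H3. rw K3. reflexivity. }
rewrite W in V.
refine (rewrite_square_ext _ _ V V'); now rewrite !span_comp_idl.
Qed.

Lemma unitor_triangle (a b c : A) (M : StructuredCospan L a b)
  (N : StructuredCospan L b c) :
  sqr (vertical_composite (associator M (unit_cospan b) N)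
         (horizontal_composite (identity_rewrite M) (left_unitor N)))
  = sqr (horizontal_composite (right_unitor M) (identity_rewrite N)).
Proof.
destruct (associator_spec M (unit_cospan b) N) as [al [_ [A1 [E1 [E2 E3]]]]].
destruct (left_unitor_spec N) as [lambda [_ [Q [F1 F2]]]].
destruct (right_unitor_spec M) as [rho [_ [R [G1 G2]]]].
destruct (horizontal_row_iso (identity_presents M) Q) as [c1 [C1 [C2 C3]]].
destruct (horizontal_row_iso R (identity_presents N)) as [c2 [D1 [D2 D3]]].
rewrite comp_idr in C2, D3.
assert (V := vertical_presents_post A1 C1).
assert (W : c1 o al = c2).
{ apply (po_unique (cospan_comp_pushout (cospan_comp M (unit_cospan b)) N)).
  - apply (po_unique (cospan_comp_pushout M (unit_cospan b))).
    + rw E1. rw C2. rw D2. rw G1. reflexivity.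
    (* On the summand of the unit cospan, the two sides are the two composites from [L b] into the
       pushout. *)
    + rw E2. rw C3. rw F1. rw D2. rw G2. symmetry.
      apply (po_comm (cospan_comp_pushout M N)).
  - rw E3. rw C3. rw F2. rw D3. reflexivity. }
rewrite W in V.
exact (rewrite_square_ext (span_comp_idl _) (span_comp_idl _) V D1).
Qed.

(** * The double category and the shape of its composites *)

Definition rewriting_double_category : DoubleCategoryOn (FineRewriteGraph L) :=
  {| vert := rewriting_vertical;
     hunit := unit_cospan;
     hunit_sq := @unit_rewrite;
     hunit_id := unit_rewrite_id;
     hunit_comp := @unit_rewrite_comp;
     hcomp := @cospan_comp;
     hcomp_sq := @horizontal_composite;
     hcomp_id := @horizontal_id;
     hcomp_comp := @interchange;
     hassoc := @associator;
     hlunit := @left_unitor;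
     hrunit := @right_unitor;
     hassoc_iso := @associator_iso;
     hlunit_iso := @left_unitor_iso;
     hrunit_iso := @right_unitor_iso;
     hassoc_nat := @associator_natural;
     hlunit_nat := @left_unitor_natural;
     hrunit_nat := @right_unitor_natural;
     pentagon := @associator_pentagon;
     triangle := @unitor_triangle |}.

(** Any member of the composite class serves as [r]: its presentation identifies its central object
    with the pullback, and the equations on outer legs are tested after the monic [up s] and
    [up t]. *)
Lemma vertical_composite_squares (a a' c c' e e' : A) (u : InvSpan a c)
  (v : InvSpan a' c') (u' : InvSpan c e) (v' : InvSpan c' e')
  (M : StructuredCospan L a a') (N : StructuredCospan L c c')
  (K : StructuredCospan L e e')
  (x : FineRewrite u v M N) (y : FineRewrite u' v' N K)
  (s : SpanOfCospans u v M N) (t : SpanOfCospans u' v' N K) :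
  InClass s x -> InClass t y ->
  exists r, InClass r (vertical_composite x y)
    /\ VerticalComposite (span_proj1 u u') (span_proj2 u u')
         (span_proj1 v v') (span_proj2 v v') s t r.
Proof.
intros Hs Ht. assert (S := presents_member Hs). assert (S' := presents_member Ht).
destruct (pullback_exists (topos_limits T) (down s) (up t)) as [p [q1 [q2 Q]]].
assert (P := vertical_composite_presents S S' Q).
destruct (presents_mono S) as [Ms _]. destruct (presents_mono S') as [Mt _].
destruct (class_inhabited (vertical_composite x y)) as [r [Hr _]].
destruct (proj1 (P r) Hr) as [theta [I [T1 T2]]].
assert (Q' := pb_change Q (iso_id _) (iso_id _) (iso_inv I)
                (comp_idr _) (comp_idr _)).
rewrite !comp_idl in Q'. assert (E := pb_comm Q').
assert (U : up r = up s o (q1 o inv I)).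
{ rewrite comp_assoc, <- T1. rw (inv_r I). reflexivity. }
assert (D : down r = down t o (q2 o inv I)).
{ rewrite comp_assoc, <- T2. rw (inv_r I). reflexivity. }
assert (C : forall (f g h : A) (i : InvSpan f g) (j : InvSpan g h),
   sup (span_comp i j) = sup i o span_proj1 i j
   /\ sdown i o span_proj1 i j = sup j o span_proj2 i j).
{ intros f g h i j. destruct (span_comp_composite i j) as [B [B' _]].
  split; [exact B' | exact (pb_comm B)]. }
assert (Left : q1 o inv I o cleft (mid r)
               = cleft (mid s) o fmap L (span_proj1 u u')).
{ apply Ms. rewrite !comp_assoc. rewrite comp_assoc in U. rewrite <- U, !up_left.
  rewrite <- comp_assoc, <- fmap_comp. now rewrite (proj1 (C _ _ _ u u')). }
assert (Right : q1 o inv I o cright (mid r)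
               = cright (mid s) o fmap L (span_proj1 v v')).
{ apply Ms. rewrite !comp_assoc. rewrite comp_assoc in U. rewrite <- U, !up_right.
  rewrite <- comp_assoc, <- fmap_comp. now rewrite (proj1 (C _ _ _ v v')). }
exists r. split; [exact Hr |]. exists (q1 o inv I), (q2 o inv I).
split; [exact Q' |]. split; [exact U |]. split; [exact D |].
split; [exact Left |]. split; [| split; [exact Right |]].
- apply Mt. rewrite (comp_assoc (up t) (q2 o inv I)), <- E.
  rewrite <- (comp_assoc (down s)), Left, !comp_assoc, down_left, up_left.
  rewrite <- !comp_assoc, <- !fmap_comp. now rewrite (proj2 (C _ _ _ u u')).
- apply Mt. rewrite (comp_assoc (up t) (q2 o inv I)), <- E.
  rewrite <- (comp_assoc (down s)), Right, !comp_assoc, down_right, up_right.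
  rewrite <- !comp_assoc, <- !fmap_comp. now rewrite (proj2 (C _ _ _ v v')).
Qed.

Lemma horizontal_composite_squares (a b c a' b' c' : A)
  (u : InvSpan a a') (v : InvSpan b b') (w : InvSpan c c')
  (M : StructuredCospan L a b) (N : StructuredCospan L b c)
  (M' : StructuredCospan L a' b') (N' : StructuredCospan L b' c')
  (x : FineRewrite u v M M') (y : FineRewrite v w N N')
  (s : SpanOfCospans u v M M') (t : SpanOfCospans v w N N') :
  InClass s x -> InClass t y ->
  exists r, InClass r (horizontal_composite x y)
    /\ HorizontalComposite (in1 M N) (in2 M N) (in1 M' N') (in2 M' N') s t r.
Proof.
intros Hs Ht. assert (S := presents_member Hs). assert (S' := presents_member Ht).
assert (I := fmap_iso (sup_iso v)).
assert (R : up s o (cright (mid s) o inv I) = cright M).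
{ rw (up_right s). rw (inv_r I). reflexivity. }
assert (R' : down s o (cright (mid s) o inv I) = cright M' o side v).
{ rw (down_right s). rewrite <- (side_sup v). rw (inv_r I). reflexivity. }
assert (K : up t o (cleft (mid t) o inv I) = cleft N).
{ rw (up_left t). rw (inv_r I). reflexivity. }
assert (K' : down t o (cleft (mid t) o inv I) = cleft N' o side v).
{ rw (down_left t). rewrite <- (side_sup v). rw (inv_r I). reflexivity. }
assert (O := po_comm (cospan_comp_pushout M N)).
assert (O' := po_comm (cospan_comp_pushout M' N')).
destruct (pushout_exists T (cright (mid s) o inv I) (cleft (mid t) o inv I))
  as [z [z1 [z2 Z]]].
destruct (po_desc Z (h := in1 M N o up s) (k := in2 M N o up t)) as [U [U1 U2]].
{ now rewrite <- !(comp_assoc _ _ (_ o _)), R, K. }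
destruct (po_desc Z (h := in1 M' N' o down s) (k := in2 M' N' o down t))
  as [D [D1 D2]].
{ rewrite <- !(comp_assoc _ _ (_ o _)), R', K', !comp_assoc. now rewrite O'. }
assert (P := horizontal_composite_presents S S' R K Z U1 U2 D1 D2).
destruct (presents_mono P) as [MU _].
destruct (class_inhabited (horizontal_composite x y)) as [r [Hr _]].
destruct (proj1 (P r) Hr) as [theta [J [T1 T2]]].
assert (Mr : Mono (up r)).
{ exact (proj1 (presents_mono (presents_member Hr))). }
(* The presented pushout is over [L b], the required one over the image of the apex of [v];
   precomposition with the invertible [fmap L (sup v)] passes from one to the other. *)
assert (Z' := po_of_iso (po_precomp I Z) J eq_refl eq_refl).
rewrite <- !(comp_assoc _ (inv I)), (inv_l I), !comp_idr in Z'.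
exists r. split; [exact Hr |]. exists (theta o z1), (theta o z2).
split; [split; [exact Z' | split] |].
- apply Mr. rewrite up_left, cospan_comp_left. rw T1. rw U1. rw (up_left s). reflexivity.
- apply Mr. rewrite up_right, cospan_comp_right. rw T1. rw U2. rw (up_right t).
  reflexivity.
- repeat split; rewrite comp_assoc; [rewrite T1 | rewrite T1 | rewrite T2 | rewrite T2];
    assumption.
Qed.

End Composites.

End FineRewrites.

Theorem proposition25 (A X : Category) (L : Functor A X) (R : Functor X A)
  (topos_A : IsTopos A) (topos_X : IsTopos X)
  (adj : Adjunction L R) (L_pullbacks : PreservesPullbacks L) :
  exists D : DoubleCategoryOn (FineRewriteGraph L),
  exists p1 p2 i1 i2,
    ComposesByPullbackAndPushout (D := D) p1 p2 i1 i2.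
Proof.
exists (rewriting_double_category L topos_X).
exists (@span_proj1 A), (@span_proj2 A), (@in1 A X L topos_X), (@in2 A X L topos_X).
constructor.
- exact (@span_comp_composite A).
- exact (@cospan_comp_composite A X L topos_X).
- exact (@vertical_composite_squares A X L topos_X).
- exact (@horizontal_composite_squares A X L topos_X).
Qed.
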